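(* Consider the learning process (beliefs $\mu_i^{(t)}$, strategies $x_i^{(t)}$, costs $y_i^{(t)}$) described in the context. Suppose that: (1) there is a constant $L>0$ with $\max_i\max_{\theta',\theta''\in\Theta}\max_{x\in\mathcal X}\sup_{y_i}\left|\log\frac{f_i(y_i|x,\theta')}{f_i(y_i|x,\theta'')}\right|\le L$, and for each $i\in\mathcal N$ and each $\theta\in\Theta$, $f_i(y_i|x,\theta)$ is continuous in $x$; (2) for every $\theta\in\Theta$ with $\theta\ne\theta^*$ there is at least one agent $i\in\mathcal N$ for which $D_{KL}(f_i(y_i|x,\theta^* )\|f_i(y_i|x,\theta))>0$ for all $x\in\mathcal X$; (3) the undirected graph $\mathcal G(\mathcal N,\mathcal E)$ is connected and $W$ is doubly stochastic, i.e. $\sum_{j=1}^N w_{ij}=\sum_{i=1}^N w_{ij}=1$; (4) $0<\alpha^{(t)}<1$, $\sum_{t=0}^\infty\alpha^{(t)}=\infty$ and $\sum_{t=0}^\infty(\alpha^{(t)})^2<\infty$; (5) for every $i\in\mathcal N$ and $\theta\in\Theta$, $u_i(x_i,x_{-i},\theta)$ is continuous in $x$ and strictly convex in $x_i$; (6) with $\mu$ the common limit belief of the agents, for any $x^{(0)}\in\mathcal X$ the solution $\bar x(t)$ of the continuous-time best-response dynamics $$\frac{d\bar x_i(t)}{dt}\in\mathrm{BR}_i(\bar x_{-i}(t),\mu)-\bar x_i(t),\qquad \bar x_i(0)=x_i^{(0)},\qquad i\in\mathcal N,$$ converges to the Nash equilibrium of the game with common belief $\mu$, i.e. $\lim_{t\to\infty}\bar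 x(t)=x^*(\mu)$. Then for each agent $i\in\mathcal N$ and each $\theta_k\in\Theta$, $$\lim_{T\to\infty}\frac{1}{\sum_{t=1}^T\alpha^{(t)}}\log\frac{\mu_i^{(T+1)}(\theta^* )}{\mu_i^{(T+1)}(\theta_k)}=Z(\theta^*,\theta_k)\quad\text{almost surely},$$ where $$Z(\theta^*,\theta_k)=\frac1N\sum_{j=1}^N D_{KL}\big(f_j(y_j|x^*(\mu),\theta^* )\,\|\,f_j(y_j|x^*(\mu),\theta_k)\big).$$ In particular, $\mu_i^{(t)}(\theta^* )\to1$ almost surely as $t\to\infty$ for each $i\in\mathcal N$.
   Context: Game. $\mathcal N=\{1,\dots,N\}$ is the set of agents. Agent $i$ has a strategy $x_i$ in a convex compact set $\mathcal X_i$ (in a Euclidean space); $\mathcal X=\prod_i\mathcal X_i$, $x=(x_1,\dots,x_N)$, and $x_{-i}$ denotes the strategies of all agents except $i$. $\Theta=\{\theta_1,\dots,\theta_M\}$ is a finite parameter set and $\theta^*\in\Theta$ is the (unknown) true parameter. $\Delta(\Theta)$ is the set of probability distributions on $\Theta$. The cost functions are $u_i:\mathcal X\times\Theta\to\mathbb R$. Given $x$ and $\theta$, the realized cost of agent $i$ is $y_i=u_i(x,\theta)+\epsilon_i(x,\theta)$ with zero-mean noise $\epsilon_i(x,\theta)$; its probability density (likelihood function) is $f_i(y_i|x,\theta)$, which is positive on the set of values of $y_i$ over which suprema over $y_i$ are taken. $D_{KL}(P\|P')=\mathbb E_P[\log\frac{P}{P'}]$ is the Kullback-Leibler divergence. For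 $\mu\in\Delta(\Theta)$ let $u_i(x,\mu)=\sum_{\theta\in\Theta}\mu(\theta)u_i(x,\theta)$ and $\mathrm{BR}_i(x_{-i},\mu)=\arg\min_{x_i\in\mathcal X_i}u_i(x_i,x_{-i},\mu)$. The Nash equilibrium of the game with common belief $\mu$ is the strategy profile $x^*(\mu)\in\mathcal X$ with $u_i(x_i^*(\mu),x_{-i}^*(\mu),\mu)\le u_i(x_i,x_{-i}^*(\mu),\mu)$ for all $x_i\in\mathcal X_i$ and all $i\in\mathcal N$. Network. $\mathcal G(\mathcal N,\mathcal E)$ is an undirected graph with node set $\mathcal N$ and edge set $\mathcal E$, $\mathcal N_i=\{j\in\mathcal N:(j,i)\in\mathcal E\}$ is the set of neighbors of $i$, and $W=[w_{ij}]\in\mathbb R^{N\times N}$ is a non-negative weight matrix with $w_{ij}>0$ if and only if $j\in\mathcal N_i$. Learning process. Let $\{\alpha^{(t)}\}_{t\ge0}$ be a non-increasing non-negative step-size sequence. Initialize $x_i^{(0)}\in\mathcal X_i$ and $\mu_i^{(0)}(\theta_k)=1/M$ for all $i,k$. At each time $t=0,1,2,\dots$: conditionally on the past and on $x^{(t)}$, the costs $(y_1^{(t)},\dots,y_N^{(t)})$ are drawn from the product density $\prod_{j=1}^N f_j(y_j|x^{(t)},\theta^* )$; then for each $i\in\mathcal N$ and $k=1,\dots,M$, $$b_i^{(t)}(\theta_k)=\frac{f_i(y_i^{(t)}|x^{(t)},\theta_k)^{\alpha^{(t)}}\mu_i^{(t)}(\theta_k)}{\sum_{\theta\in\Theta}f_i(y_i^{(t)}|x^{(t)},\theta)^{\alpha^{(t)}}\mu_i^{(t)}(\theta)},\qquad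 \mu_i^{(t+1)}(\theta_k)=\frac{\exp\big(\sum_{j=1}^N w_{ij}\log b_j^{(t)}(\theta_k)\big)}{\sum_{\theta\in\Theta}\exp\big(\sum_{j=1}^N w_{ij}\log b_j^{(t)}(\theta)\big)},$$ $$x_i^{(t+1)}\in(1-\alpha^{(t)})x_i^{(t)}+\alpha^{(t)}\mathrm{BR}_i(x_{-i}^{(t)},\mu_i^{(t+1)}).$$ Common limit belief. $\mu$ denotes the (random) belief in $\Delta(\Theta)$ that is the almost sure limit of $\mu_i^{(t)}$ as $t\to\infty$, the same for every agent $i$ (a separate result of the same work asserts that this limit exists under hypotheses (1), (3), (4)), given by $\mu(\theta_k)=\nu_k/\sum_{l=1}^M\nu_l$, where $\nu_k$ is the almost sure limit of $\frac1N\sum_{i=1}^N\frac{\mu_i^{(t)}(\theta_k)}{\mu_i^{(t)}(\theta^* )}$. *)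

(* Defs.v *)
From HB Require Import structures.
From mathcomp Require Import all_boot all_order all_algebra.
From mathcomp Require Import all_classical all_reals all_analysis.


Import Order.TTheory GRing.Theory Num.Theory.
Import numFieldNormedType.Exports.

Local Open Scope classical_set_scope.
Local Open Scope ring_scope.

(* Strategy profiles, with the product topology. *)
Definition profile (R : realType) {N : nat} (n : 'I_N -> nat) :=
  prod_topology (fun i : 'I_N => 'rV[R]_(n i)).

Section game.
Context {R : realType} {N : nat} {n : 'I_N -> nat} {Theta : finType}.
Variables (X : forall i : 'I_N, set 'rV[R]_(n i)).
Variables (u : 'I_N -> profile R n -> Theta -> R).

Definition profiles : set (profile R n) := [set x | forall i, X i (x i)].

(* The profile (z, x_{-i}). *)
Definition deviate (x : profile R n) (i : 'I_N) (z : 'rV[R]_(n i)) :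
  profile R n := dfwith x i z.

Definition is_belief (m : Theta -> R) : Prop :=
  (forall th, 0 <= m th) /\ \sum_th m th = 1.

Definition mean_cost (i : 'I_N) (x : profile R n) (m : Theta -> R) : R :=
  \sum_th m th * u i x th.

Definition best_response (i : 'I_N) (x : profile R n) (m : Theta -> R) :
    set 'rV[R]_(n i) :=
  [set z | X i z /\ forall z', X i z' ->
     mean_cost i (deviate x i z) m <= mean_cost i (deviate x i z') m].

Definition nash_equilibrium (m : Theta -> R) (x : profile R n) : Prop :=
  profiles x /\ forall i (z : 'rV[R]_(n i)), X i z ->
    mean_cost i x m <= mean_cost i (deviate x i z) m.

Definition strictly_convex_own (i : 'I_N) (g : profile R n -> R) : Prop :=
  forall x, profiles x -> forall z z', X i z -> X i z' -> z != z' ->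
  forall s : R, 0 < s < 1 ->
    g (deviate x i (s *: z + (1 - s) *: z'))
    < s * g (deviate x i z) + (1 - s) * g (deviate x i z').

(* Classical solutions: when the costs are continuous and strictly convex in
   the player's own strategy, best responses over compact convex sets are
   single-valued and continuous in the profile, so that every absolutely
   continuous solution of the differential inclusion is C^1. *)
Definition best_response_dynamics (m : Theta -> R) (x0 : profile R n)
    (xb : R -> profile R n) : Prop :=
  [/\ xb 0 = x0,
      forall t, 0 <= t -> profiles (xb t),
      {within `[0, +oo[, continuous xb} &
      forall t, 0 < t -> forall i, exists2 z, best_response i (xb t) m z &
        is_derive t 1 (fun s : R => xb s i) (z - xb t i)].

(* [f i v x th] is f_i(v | x, th), a density with respect to Lebesgue measure.
   [Y i x] is the set of values of the cost of agent i over which suprema are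
   taken; it may depend on the profile but not on the parameter, since the
   log-likelihood ratios are finite on it. The last two clauses say that the
   noise v - u_i(x, th) has mean zero. *)
Definition likelihood_model (f : 'I_N -> R -> profile R n -> Theta -> R)
    (Y : 'I_N -> profile R n -> set R) : Prop :=
  forall i x th, profiles x ->
  [/\ measurable_fun setT (fun v => f i v x th),
      forall v, Y i x v -> 0 < f i v x th,
      forall v, ~ Y i x v -> f i v x th = 0 &
      [/\ (\int[lebesgue_measure]_v (f i v x th)%:E = 1)%E,
          lebesgue_measure.-integrable setT (fun v => (v * f i v x th)%:E) &
          (\int[lebesgue_measure]_v (v * f i v x th)%:E = (u i x th)%:E)%E]].

End game.

(* Kullback-Leibler divergence of two Lebesgue densities. By the conventions
   a / 0 = 0 and ln 0 = 0, points where q vanishes contribute 0: this is the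
   usual divergence only when q is positive wherever p is. *)
Definition KL {R : realType} (p q : R -> R) : \bar R :=
  (\int[lebesgue_measure]_v (p v * ln (p v / q v))%:E)%E.

Definition connected_network {N : nat} (e : rel 'I_N) : Prop :=
  symmetric e /\ forall i j, connect e i j.

Definition weight_matrix {R : realType} {N : nat} (e : rel 'I_N)
    (W : 'M[R]_N) : Prop :=
  forall i j, 0 <= W i j /\ (0 < W i j <-> e j i).

Definition doubly_stochastic {R : realType} {N : nat} (W : 'M[R]_N) : Prop :=
  (forall i, \sum_j W i j = 1) /\ (forall j, \sum_i W i j = 1).

Section learning.
Context {R : realType} {d : measure_display} {Omega : measurableType d}.
Context {N : nat} {n : 'I_N -> nat} {Theta : finType}.
Variables (f : 'I_N -> R -> profile R n -> Theta -> R).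
Variables (W : 'M[R]_N) (alpha : nat -> R).
Variables (x : nat -> Omega -> profile R n) (y : nat -> Omega -> 'I_N -> R).

Definition bayes_update (a : R) (lik m : Theta -> R) (th : Theta) : R :=
  lik th `^ a * m th / \sum_th' (lik th' `^ a * m th').

Definition log_linear_pool (b : 'I_N -> Theta -> R) (i : 'I_N) (th : Theta)
    : R :=
  expR (\sum_j W i j * ln (b j th))
  / \sum_th' expR (\sum_j W i j * ln (b j th')).

Fixpoint belief (t : nat) (w : Omega) : 'I_N -> Theta -> R :=
  if t is s.+1 then
    log_linear_pool (fun j => bayes_update (alpha s)
                       (f j (y s w j) (x s w)) (belief s w j))
  else fun _ _ => #|Theta|%:R^-1.

(* The sigma-algebra generated by x^(0), ..., x^(t) and y^(0), ..., y^(t-1);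
   the beliefs up to time t are functions of these. *)
Definition past (t : nat) : set (set Omega) :=
  <<s [set A |
       (exists (s : nat) (i : 'I_N) (k : 'I_(n i)) (B : set R),
          [/\ (s <= t)%N, measurable B &
              A = (fun w => x s w i ord0 k) @^-1` B]) \/
       (exists (s : nat) (i : 'I_N) (B : set R),
          [/\ (s < t)%N, measurable B & A = (fun w => y s w i) @^-1` B])] >>.

(* Conditionally on [past t], the vector y^(t) has the product density
   of the f_j(. | x^(t), ths). *)
Definition costs_drawn (P : probability Omega R) (ths : Theta) : Prop :=
  forall (t : nat) (A : set Omega) (B : 'I_N -> set R),
    past t A -> (forall j, measurable (B j)) ->
    P (A `&` [set w | forall j, B j (y t w j)]) =
    (\int[P]_(w in A)
      (\prod_j \int[lebesgue_measure]_(v in B j) f j v (x t w) ths)%R%:E)%E.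

Definition learning_process (P : probability Omega R)
    (X : forall i : 'I_N, set 'rV[R]_(n i))
    (u : 'I_N -> profile R n -> Theta -> R) (ths : Theta) : Prop :=
  [/\ forall t i (k : 'I_(n i)),
        measurable_fun setT (fun w => x t w i ord0 k),
      forall t i, measurable_fun setT (fun w => y t w i),
      forall w, profiles X (x 0%N w),
      costs_drawn P ths &
      forall t w i, exists2 z,
        best_response X u i (x t w) (belief t.+1 w i) z &
        x t.+1 w i = (1 - alpha t) *: x t w i + alpha t *: z].

Definition common_limit_belief (P : probability Omega R) (ths : Theta)
    (nu mu : Omega -> Theta -> R) : Prop :=
  {ae P, forall w,
    [/\ forall th, N%:R^-1 * (\sum_i belief t w i th / belief t w i ths)
          @[t --> \oo] --> nu w th,
        forall th, mu w th = nu w th / \sum_th' nu w th',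
        is_belief (mu w) &
        forall i th, belief t w i th @[t --> \oo] --> mu w th]}.

End learning.

Definition Zdiv {R : realType} {N : nat} {n : 'I_N -> nat} {Theta : finType}
    (f : 'I_N -> R -> profile R n -> Theta -> R) (x : profile R n)
    (ths th : Theta) : \bar R :=
  ((N%:R^-1)%:E *
   \sum_(j < N) KL (fun v => f j v x ths) (fun v => f j v x th))%E.

(* Main.v *)
Require Import Defs.
From mathcomp Require Import all_boot all_order all_algebra.
From mathcomp Require Import all_classical all_reals all_analysis.
From mathcomp Require Import measurable_realfun ring lra.
Import Order.TTheory GRing.Theory Num.Theory.
Import numFieldNormedType.Exports.
Local Open Scope classical_set_scope.
Local Open Scope ring_scope.

(** The log-belief ratios [ln (mu_i ths / mu_i th)] obey a linear recursion: Bayes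
updating adds [alpha t] times the log-likelihood ratio of the observed cost, and
log-linear pooling averages over the neighbours with the weights [W]
([log_belief_ratioS]). The log-likelihood ratio splits into its conditional mean given
the past, the divergence at the current profile, and a bounded conditionally centred
noise. Write S for the clock, the running sum of the step sizes.

Noise ([noise_negligible]). The pooled noise has second moments bounded by a multiple
of the sum of the squared step sizes: increments are orthogonal to the past, and the
stochastic rows of [W] do not increase second moments. Along the steps where S passes
the integers the second moments of noise / S are therefore summable; in between the
noise moves by a bounded amount. Hence noise / S tends to 0 almost surely. That the noise is centred given the past requires
evaluating the density of a cost at a random profile. This is done by discretizing
profiles into finitely many cells, and passing to the limit with Scheffe's theorem and
with the fact that the density is almost surely positive at the sample ([law_state],
[density_at_sample_gt0]).

Strategies ([clock_average_cvg0]). The strategies are Euler steps of the best-response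
dynamics, with beliefs that converge to [mu]. Global attraction of the equilibrium does
not imply its stability, so that the strategies need not converge. But their
averages over clock time do: limits of late windows of the trajectory are solutions
of the dynamics, each of which converges to the equilibrium, and so the trajectory
spends an asymptotically negligible proportion of clock time away from the
equilibrium. This is all that the averaged divergences see.

Network ([consensus_log_ratio]). A constant drift vector c is its mean plus a coboundary
h - W h, by connectedness and double stochasticity ([poisson_equation]). Since the step
sizes do not increase, the pooled response to a coboundary stays bounded
([coboundary_forcing_bounded]), so that every agent accumulates the mean of c per unit
of clock time, even if [W] is periodic.

Together, the log-ratios divided by S tend to the mean divergence at the equilibrium.
It is positive for every wrong parameter, by Gibbs' inequality and identifiability, so
the log-ratios diverge and the beliefs concentrate on the true parameter. *)

Set Implicit Arguments.
Unset Strict Implicit.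
Unset Printing Implicit Defensive.

(** * Consensus over the network *)

Section network.
Context {R : realType} {N : nat}.
Implicit Types (W : 'M[R]_N) (e : rel 'I_N).

Definition averaged W (a : 'I_N -> R) (i : 'I_N) : R := \sum_j W i j * a j.

Definition mean (c : 'I_N -> R) : R := N%:R^-1 * \sum_j c j.

Lemma averagedD W a b i :
  averaged W (fun j => a j + b j) i = averaged W a i + averaged W b i.
Proof. by rewrite /averaged -big_split; apply: eq_bigr => j _ /=; rewrite mulrDr. Qed.

Lemma averagedB W a b i :
  averaged W (fun j => a j - b j) i = averaged W a i - averaged W b i.
Proof. by rewrite /averaged -sumrB; apply: eq_bigr => j _ /=; rewrite mulrBr. Qed.

Lemma averagedZ W k a i : averaged W (fun j => k * a j) i = k * averaged W a i.
Proof. by rewrite /averaged mulr_sumr; apply: eq_bigr => j _; rewrite mulrCA. Qed.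

Definition row_stochastic W :=
  (forall i j, 0 <= W i j) /\ forall i, \sum_j W i j = 1.

Lemma weight_row_stochastic e W :
  weight_matrix e W -> doubly_stochastic W -> row_stochastic W.
Proof. by move=> hW [r _]; split=> // i j; case: (hW i j). Qed.

Lemma averaged_cst W k i : row_stochastic W -> averaged W (fun=> k) i = k.
Proof. by move=> [_ sW]; rewrite /averaged -mulr_suml sW mul1r. Qed.

Lemma averaged_bound W a K : row_stochastic W ->
  (forall j, `|a j| <= K) -> forall i, `|averaged W a i| <= K.
Proof.
move=> [W0 W1] aK i; apply: (le_trans (ler_norm_sum _ _ _)).
rewrite -[leRHS]mul1r -(W1 i) mulr_suml; apply: ler_sum => j _.
by rewrite normrM (ger0_norm (W0 i j)) ler_wpM2l.
Qed.

(** Discrete maximum principle: the set where a harmonic function is maximal is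
closed under taking neighbours. *)
Lemma harmonic_constant e W (v : 'I_N -> R) :
  weight_matrix e W -> connected_network e -> doubly_stochastic W ->
  (forall j, \sum_i W i j * v i = v j) -> forall i j, v i = v j.
Proof.
move=> hW [esym econn] [_ cW] hv i0 j0.
have [m mmax] : exists m, forall j, v j <= v m.
  have [m _ mP] := Order.TotalTheory.arg_maxP v (isT : xpredT i0).
  by exists m => j; exact: mP.
suff vm : forall j, v j = v m by rewrite !vm.
move=> j.
have step : forall a b, v a = v m -> e a b -> v b = v m.
  move=> a b va eab; have Wba : 0 < W b a by apply: ((hW b a).2).2.
  have gap0 i : true -> 0 <= W i a * (v m - v i).
    by move=> _; rewrite mulr_ge0 ?subr_ge0; [|exact: (hW i a).1|exact: mmax].
  have gaps : \sum_i W i a * (v m - v i) = 0.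
    under eq_bigr do rewrite mulrBr.
    by rewrite sumrB hv -mulr_suml cW mul1r va subrr.
  have /(_ b isT)/eqP := psumr_eq0P gap0 gaps.
  by rewrite mulf_eq0 gt_eqF //= subr_eq0 => /eqP.
have /connectP[p pp ->] := econn m j.
suff along : forall a, path e a p -> v a = v m -> v (last a p) = v m.
  exact: along pp (erefl _).
elim: p {pp} => [|b p IH] a //= /andP[eab pp] va.
exact: IH pp (step _ _ va eab).
Qed.

(** A vector is in the range of id - W as soon as it annihilates the cokernel, which
consists of vectors harmonic for the transpose of [W], hence of constant vectors. *)
Lemma poisson_equation e W (c : 'I_N -> R) :
  weight_matrix e W -> connected_network e -> doubly_stochastic W ->
  exists h, forall i, c i - mean c = h i - averaged W h i.
Proof.
move=> hW he hD.
have [N0|N_gt0] := posnP N.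
  by exists (fun=> 0) => -[k kN]; exfalso; move: kN; rewrite N0.
pose r := \row_i (c i - mean c); pose M := 1%:M - W^T.
have sum_r : \sum_i r 0 i = 0.
  under eq_bigr do rewrite mxE.
  rewrite sumrB sumr_const card_ord -mulr_natl /mean mulVKf ?subrr //.
  by rewrite pnatr_eq0 -lt0n.
have /submxP[h rh] : (r <= M)%MS.
  rewrite submxE; apply/eqP/rowP => k; rewrite !mxE.
  pose v i := cokermx M i k.
  have vcst : forall i j, v i = v j.
    apply: (harmonic_constant hW he hD) => j.
    have : (M *m cokermx M) j k = 0 by rewrite mulmx_coker mxE.
    rewrite mulmxBl mul1mx mxE [X in _ + X]mxE -/(v j) mxE => /eqP.
    rewrite subr_eq0 => /eqP ->.
    by apply: eq_bigr => i _; rewrite mxE.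
  pose i0 := Ordinal N_gt0.
  under eq_bigr => j _ do rewrite -/(v j) (vcst j i0).
  by rewrite -mulr_suml sum_r mul0r.
exists (h 0) => i; move/rowP/(_ i): rh.
rewrite mulmxBr mulmx1 !mxE => ->; congr (_ - _).
by apply: eq_bigr => j _; rewrite mxE mulrC.
Qed.

(** Subtracting [alpha T * W h] from the state turns the forcing by coboundaries
[h - W h] into one by the increments of [alpha], and these telescope. This
is where the monotonicity of the step sizes enters; without it a periodic
[W] could resonate with the step sizes. *)
Lemma coboundary_forcing_bounded W (alpha : nat -> R) h (U : nat -> 'I_N -> R) :
  row_stochastic W ->
  (forall t, 0 <= alpha t) -> (forall t, alpha t.+1 <= alpha t) ->
  (forall i, U 0%N i = 0) ->
  (forall t i, U t.+1 i =
     averaged W (fun j => U t j + alpha t * (h j - averaged W h j)) i) ->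
  exists B, forall t i, `|U t i| <= B.
Proof.
move=> sW a0 amono U0 US.
pose K := \sum_j `|h j|.
have hK j : `|h j| <= K by rewrite /K (bigD1 j) //= lerDl sumr_ge0.
have WhK j : `|averaged W h j| <= K by exact: averaged_bound.
pose Q t i := U t i - alpha t * averaged W h i.
have QS t i : Q t.+1 i =
    averaged W (fun j => Q t j + (alpha t - alpha t.+1) * h j) i.
  rewrite /Q US -averagedZ -averagedB; apply: eq_bigr => j _; congr (_ * _).
  ring.
have Qb t i : `|Q t i| <= (alpha 0%N - alpha t + alpha 0%N) * K.
  elim: t i => [|t IH] i.
    rewrite /Q U0 sub0r normrN normrM ger0_norm // subrr add0r ler_wpM2l //.
  rewrite QS; apply: averaged_bound => // j.
  apply: (le_trans (ler_normD _ _)).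
  have -> : (alpha 0%N - alpha t.+1 + alpha 0%N) * K =
     (alpha 0%N - alpha t + alpha 0%N) * K + (alpha t - alpha t.+1) * K by ring.
  by rewrite lerD // normrM ger0_norm ?subr_ge0 // ler_wpM2l ?subr_ge0.
exists (3%:R * alpha 0%N * K) => t i.
have a_le s : alpha s <= alpha 0%N by elim: s => // s /(le_trans (amono s)).
have -> : U t i = Q t i + alpha t * averaged W h i by rewrite /Q subrK.
apply: (le_trans (ler_normD _ _)).
apply: (@le_trans _ _ ((alpha 0%N - alpha t + alpha 0%N) * K + alpha t * K)).
  by rewrite lerD // normrM ger0_norm // ler_wpM2l.
rewrite -mulrDl ler_wpM2r //; first by rewrite sumr_ge0.
by have := a0 0%N; lra.
Qed.

Definition clock (alpha : nat -> R) (T : nat) : R := \sum_(0 <= t < T) alpha t.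

Lemma clockS alpha T : clock alpha T.+1 = clock alpha T + alpha T.
Proof. by rewrite /clock big_nat_recr. Qed.

Lemma bounded_over_diverging (U S : nat -> R) (B : R) :
  (forall T, `|U T| <= B) -> S @ \oo --> +oo -> U T / S T @[T --> \oo] --> 0.
Proof.
move=> UB Sy.
have iS : (S T)^-1 @[T --> \oo] --> 0 by apply/gtr0_cvgV0 => //; move/cvgryPgt: Sy; apply.
apply/cvgr0Pnorm_lt => eps e0.
have B1 : 0 < `|B| + 1 by rewrite ltr_wpDl.
have eB : 0 < eps / (`|B| + 1) by rewrite divr_gt0.
have /cvgr0Pnorm_lt/(_ _ eB) := iS; apply: filterS => T hT.
rewrite normrM (@le_lt_trans _ _ ((`|B| + 1) * `|(S T)^-1|)) //.
  by rewrite ler_wpM2r // (le_trans (UB T)) // (le_trans (ler_norm B)) // lerDl.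
by rewrite mulrC -ltr_pdivlMr.
Qed.

(** By linearity the state is the pooled noise [V], plus the response to the
constant drift [c], plus the response to [D t - c]. The constant drift contributes
the clock times [mean c] up to a bounded coboundary response, and the last response
is at most the accumulated size of [D t - c]. The argument goes through the Poisson
equation because the powers of [W] need not converge: on a bipartite network [W] may
be periodic. *)
Lemma consensus_log_ratio e W (alpha : nat -> R) (c : 'I_N -> R)
    (lam V ell D : nat -> 'I_N -> R) :
  weight_matrix e W -> connected_network e -> doubly_stochastic W ->
  (forall t, 0 <= alpha t) -> (forall t, alpha t.+1 <= alpha t) ->
  clock alpha @ \oo --> +oo ->
  (forall i, lam 0%N i = 0) ->
  (forall t i, lam t.+1 i = averaged W (fun j => lam t j + alpha t * ell t j) i) ->
  (forall i, V 0%N i = 0) ->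
  (forall t i, V t.+1 i =
     averaged W (fun j => V t j + alpha t * (ell t j - D t j)) i) ->
  (forall i, V T i / clock alpha T @[T --> \oo] --> 0) ->
  (forall j, (\sum_(0 <= t < T) alpha t * `|D t j - c j|) / clock alpha T
     @[T --> \oo] --> 0) ->
  forall i, lam T i / clock alpha T @[T --> \oo] --> mean c.
Proof.
move=> hW he hD a0 amono Sy lam0 lamS V0 VS Vlim Dlim i.
have sW := weight_row_stochastic hW hD.
have [h hh] := poisson_equation c hW he hD.
pose U := fix U t : 'I_N -> R := if t is s.+1 then
  averaged W (fun j => U s j + alpha s * (h j - averaged W h j)) else fun=> 0.
have [B UB] := coboundary_forcing_bounded (U := U) sW a0 amono (fun=> erefl)
  (fun _ _ => erefl).
(* the response to [D t - c] *)
pose Er T i := lam T i - V T i - U T i - clock alpha T * mean c.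
have ErS T k : Er T.+1 k =
    averaged W (fun j => Er T j + alpha T * (D T j - c j)) k.
  rewrite /Er lamS VS /= clockS.
  rewrite -(averaged_cst ((clock alpha T + alpha T) * mean c) k sW) -!averagedB.
  apply: eq_bigr => j _; congr (_ * _).
  have -> : c j = mean c + (h j - averaged W h j) by rewrite -hh; ring.
  ring.
pose G T := \sum_j \sum_(0 <= t < T) alpha t * `|D t j - c j|.
have ErG T k : `|Er T k| <= G T.
  elim: T k => [|T IH] k.
    rewrite /Er /G /clock lam0 V0 /= !big_nil !mul0r !subr0 normr0 sumr_ge0 // => j _.
    by rewrite big_nil.
  rewrite ErS; apply: averaged_bound => // j.
  apply: (le_trans (ler_normD _ _)).
  have -> : G T.+1 = G T + \sum_j alpha T * `|D T j - c j|.
    by rewrite /G -big_split /=; apply: eq_bigr => j' _; rewrite big_nat_recr.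
  rewrite lerD // (bigD1 j) //= normrM ger0_norm // lerDl sumr_ge0 // => j' _.
  by rewrite mulr_ge0.
have Glim : G T / clock alpha T @[T --> \oo] --> 0.
  under eq_fun do rewrite /G mulr_suml.
  rewrite [X in nbhs X](_ : 0 = \sum_(j < N) (0 : R)); last by rewrite big1.
  by apply: cvg_big => [|j _]; [exact: add_continuous|exact: Dlim].
have Erlim : Er T i / clock alpha T @[T --> \oo] --> 0.
  apply/norm_cvg0P; apply: (squeeze_cvgr _ _ Glim); last exact: cvg_cst.
  have /cvgryPgt/(_ 0) := Sy; apply: filterS => T ST0.
  by rewrite normr_ge0 normrM normfV (gtr0_norm ST0) ler_pM2r ?invr_gt0 ?ErG.
have Ulim : U T i / clock alpha T @[T --> \oo] --> 0.
  by apply: (bounded_over_diverging (UB^~ i)).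
have lim0 : Er T i / clock alpha T + V T i / clock alpha T
    + U T i / clock alpha T + mean c @[T --> \oo] --> 0 + 0 + 0 + mean c.
  by apply: cvgD; [do 2?apply: cvgD|exact: cvg_cst].
rewrite !add0r in lim0.
apply: cvg_trans lim0; apply: near_eq_cvg.
have /cvgryPgt/(_ 0) := Sy; apply: filterS => T ST0.
have Sn0 : clock alpha T != 0 by rewrite gt_eqF.
by rewrite /Er; field.
Qed.

End network.

(** * Best responses *)

Lemma fmap_ultra T U (h : T -> U) (F : set_system T) :
  UltraFilter F -> UltraFilter (h @ F).
Proof.
move=> UF; have PF : ProperFilter F by exact: ultra_proper.
split; [exact: fmap_proper_filter|move=> G PG FG]; rewrite eqEsubset; split=> // B GB.
have [//|FnB] := in_ultra_setVsetC (h @^-1` B) UF.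
by have [b []] := filter_ex (filterI GB (FG (~` B) FnB)).
Qed.

Lemma cvg_le_cvg (R : realType) T (F : set_system T) (f g : T -> R) (a b : R) :
  ProperFilter F -> f @ F --> a -> g @ F --> b -> (forall t, f t <= g t) -> a <= b.
Proof.
move=> FF fa gb fg; rewrite -subr_ge0.
apply: (cvgr_to_ge (cvgB gb fa)).
by apply: nearW => t; rewrite subr_ge0.
Qed.

Lemma cvg_harmonic_dist (R : realType) (V : normedModType R) (s : nat -> V) (a : V) :
  (forall k, `|a - s k| < k.+1%:R^-1) -> s @ \oo --> a.
Proof.
move=> bs; apply/cvgrPdist_lt => e e0.
have /cvgr0Pnorm_lt/(_ _ e0) := @cvg_harmonic R.
by apply: filterS => k /(le_lt_trans (ler_norm _)); exact: lt_trans.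
Qed.

Section profile_topology.
Context {R : realType} {N : nat} {n : 'I_N -> nat}.
Implicit Types (a : profile R n) (g : profile R n -> R).

Lemma cvg_profile T (F : set_system T) (h : T -> profile R n) a :
  Filter F -> (forall i, h t i @[t --> F] --> a i) -> h @ F --> a.
Proof.
move=> FF ha; apply/cvg_sup => i B [_ [[C oC <-] Ca CB]].
have hC : nbhs (a i) C by rewrite nbhsE; exists C.
have {}hC : F ((fun t => h t i) @^-1` C) := ha i _ hC.
suff : F (h @^-1` B) by [].
by apply: (filterS _ hC) => t; exact: CB.
Qed.

Lemma cvg_within_profile T (F : set_system T) A g (h : T -> profile R n) a :
  Filter F -> {within A, continuous g} -> A a -> (forall t, A (h t)) ->
  (forall i, h t i @[t --> F] --> a i) -> g (h t) @[t --> F] --> g a.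
Proof.
move=> FF /subspace_continuousP gA Aa Ah ha.
apply: cvg_trans (gA _ Aa) => B gB.
have {}gB : F (h @^-1` [set b | A b -> B (g b)]) := cvg_profile FF ha gB.
suff : F ((g \o h) @^-1` B) by [].
by apply: (filterS _ gB) => t; exact.
Qed.

Lemma near_profile_box a (e : R) : 0 < e ->
  nbhs a [set b : profile R n | forall i, `|a i - b i| < e].
Proof.
move=> e0; have FF : Filter (nbhs a) := nbhs_filter a.
have := @filter_forall _ _ (fun i => [set b : profile R n | `|a i - b i| < e]) _ FF.
apply => i.
have := @proj_continuous _ (fun i : 'I_N => 'rV[R]_(n i)) i a.
by move/cvgrPdist_lt/(_ e e0).
Qed.

(** Profile space is first countable, the boxes of radius [k.+1%:R^-1] being a
base at each point. *)
Lemma sequentially_within_continuous A g :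
  (forall (s : nat -> profile R n) a, (forall k, A (s k)) -> A a ->
     (forall i, s k i @[k --> \oo] --> a i) -> g (s k) @[k --> \oo] --> g a) ->
  {within A, continuous g}.
Proof.
move=> gseq; apply/subspace_continuousP => a Aa; apply/cvgrPdist_lt => e e0.
apply: contrapT => nge.
have ex k : exists b, [/\ A b, forall i, `|a i - b i| < k.+1%:R^-1 &
    e <= `|g a - g b|].
  apply: contrapT => nb; apply: nge.
  have k0 : 0 < k.+1%:R^-1 :> R by rewrite invr_gt0.
  have := near_profile_box a k0; apply: filterS => b ab Ab.
  by rewrite /= ltNge; apply/negP => egb; apply: nb; exists b.
have [s sP] := choice ex.
have sa i : s k i @[k --> \oo] --> a i.
  by apply: cvg_harmonic_dist => k; case: (sP k) => _ + _; apply.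
have /cvgrPdist_lt/(_ e e0)[k _ /(_ k (leqnn k))] :=
  gseq s a (fun k => let: And3 p _ _ := sP k in p) Aa sa.
by rewrite ltNge; case: (sP k) => _ _ ->.
Qed.

Lemma within_continuous_box A g a (e : R) : {within A, continuous g} -> A a ->
  0 < e -> exists2 d : R, 0 < d & forall b, A b -> (forall i, `|a i - b i| < d) ->
    `|g a - g b| < e.
Proof.
move=> gA Aa e0; apply: contrapT => nd.
have ex k : exists b, [/\ A b, forall i, `|a i - b i| < k.+1%:R^-1 &
    e <= `|g a - g b|].
  apply: contrapT => nb; apply: nd; exists k.+1%:R^-1; first by rewrite invr_gt0.
  by move=> b Ab ab; rewrite ltNge; apply/negP => egb; apply: nb; exists b.
have [s sP] := choice ex.
have sa i : s k i @[k --> \oo] --> a i.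
  by apply: cvg_harmonic_dist => k; case: (sP k) => _ + _; apply.
have As k : A (s k) by case: (sP k).
have /cvgrPdist_lt/(_ e e0)[k _ /(_ k (leqnn k))] : g (s k) @[k --> \oo] --> g a.
  exact: cvg_within_profile gA Aa As sa.
by rewrite ltNge; case: (sP k) => _ _ ->.
Qed.

Lemma cvg_coordinate T (F : set_system T) (h : T -> profile R n) a i :
  Filter F -> h @ F --> a -> h t i @[t --> F] --> a i.
Proof.
move=> FF ha B Bai.
have := @proj_continuous _ (fun i : 'I_N => 'rV[R]_(n i)) i a _ Bai.
exact: ha.
Qed.

Lemma deviate_cvg T (F : set_system T) (h : T -> profile R n) a i
    (z : T -> 'rV[R]_(n i)) (z0 : 'rV[R]_(n i)) :
  Filter F -> (forall j, h t j @[t --> F] --> a j) -> z @ F --> z0 ->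
  forall j, deviate (h t) i (z t) j @[t --> F] --> deviate a i z0 j.
Proof.
move=> FF ha zz j; rewrite /deviate.
have [ij|ij] := eqVneq i j.
  by subst j; rewrite dfwithin; under eq_fun do rewrite dfwithin.
by rewrite dfwithout //; under eq_fun do rewrite dfwithout //; exact: ha.
Qed.

End profile_topology.

Section best_responses.
Context {R : realType} {N : nat} {n : 'I_N -> nat} {Theta : finType}.
Variables (X : forall i : 'I_N, set 'rV[R]_(n i)).
Arguments X : clear implicits.
Variables (u : 'I_N -> profile R n -> Theta -> R).
Hypothesis hX : forall i, convex_set (X i) /\ compact (X i).
Hypothesis hu : forall i th, {within profiles X, continuous (fun x0 => u i x0 th)} /\
  strictly_convex_own X i (fun x0 => u i x0 th).

Lemma convexX i (z z' : 'rV[R]_(n i)) (s : R) : X i z -> X i z' -> 0 <= s <= 1 ->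
  X i (s *: z + (1 - s) *: z').
Proof.
move=> Xz Xz' /andP[sge0 sle1]; have [/convex_setW cX _] := hX i.
have [->|s0] := eqVneq s 0; first by rewrite scale0r add0r subr0 scale1r.
have [->|s1] := eqVneq s 1; first by rewrite scale1r subrr scale0r addr0.
pose k : {i01 R} := Itv01 sge0 sle1.
have := cX z z'; rewrite !inE => /(_ Xz Xz' k).
by rewrite /= !lt_neqAle s1 eq_sym s0 sge0 sle1 inE; exact.
Qed.

Lemma deviate_profile x i z : profiles X x -> X i z -> profiles X (deviate x i z).
Proof.
move=> Xx Xz j; rewrite /deviate; have [ij|ij] := eqVneq i j.
  by subst j; rewrite dfwithin.
by rewrite dfwithout.
Qed.

Lemma mean_cost_cvg T (F : set_system T) i (h : T -> profile R n) a
    (m : T -> Theta -> R) m0 :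
  Filter F -> profiles X a -> (forall t, profiles X (h t)) ->
  (forall j, h t j @[t --> F] --> a j) ->
  (forall th, m t th @[t --> F] --> m0 th) ->
  mean_cost u i (h t) (m t) @[t --> F] --> mean_cost u i a m0.
Proof.
move=> FF Xa Xh ha hm; rewrite /mean_cost.
apply: cvg_big => [|th _]; first exact: add_continuous.
apply: cvgM; first exact: hm.
exact: cvg_within_profile (hu i th).1 Xa Xh ha.
Qed.

(** At the midpoint of two distinct minimizers the mean cost would be smaller: one
of the strictly convex summands has positive weight. *)
Lemma best_response_unique i x m z z' : is_belief m -> profiles X x ->
  best_response X u i x m z -> best_response X u i x m z' -> z = z'.
Proof.
move=> [m0 m1] Xx [Xz zopt] [Xz' z'opt]; apply/eqP; apply: contrapT => /negP zz'.
have s01 : 0 < (2^-1 : R) < 1 by lra.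
pose zm := 2^-1 *: z + (1 - 2^-1) *: z'.
have Xzm : X i zm by apply: convexX => //; lra.
pose gap th := 2^-1 * u i (deviate x i z) th + (1 - 2^-1) * u i (deviate x i z') th
  - u i (deviate x i zm) th.
have gap0 th : 0 < gap th by rewrite subr_gt0; exact: (hu i th).2.
have : 0 < \sum_th m th * gap th.
  rewrite lt_neqAle sumr_ge0 ?andbT => [|th _]; last by rewrite mulr_ge0 // ltW.
  apply/negP => /eqP/esym s0.
  have F0 th : true -> 0 <= m th * gap th by rewrite mulr_ge0 // ltW.
  have : \sum_th m th = 0.
    apply: big1 => th _; have /(_ th isT)/eqP := psumr_eq0P F0 s0.
    by rewrite mulf_eq0 (gt_eqF (gap0 th)) orbF => /eqP.
  by rewrite m1 => /eqP; rewrite oner_eq0.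
have -> : \sum_th m th * gap th = 2^-1 * mean_cost u i (deviate x i z) m
    + (1 - 2^-1) * mean_cost u i (deviate x i z') m - mean_cost u i (deviate x i zm) m.
  rewrite /mean_cost !mulr_sumr -big_split -sumrB /=; apply: eq_bigr => th _.
  by rewrite /gap; ring.
have := zopt _ Xzm; have := z'opt _ Xzm; lra.
Qed.

Lemma best_response_closed T (F : set_system T) i (h : T -> profile R n) a
    (m : T -> Theta -> R) m0 (z : T -> 'rV[R]_(n i)) z0 :
  ProperFilter F -> profiles X a -> (forall t, profiles X (h t)) ->
  (forall j, h t j @[t --> F] --> a j) ->
  (forall th, m t th @[t --> F] --> m0 th) ->
  (forall t, best_response X u i (h t) (m t) (z t)) -> z @ F --> z0 ->
  X i z0 -> best_response X u i a m0 z0.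
Proof.
move=> FF Xa Xh ha hm hz zz0 Xz0; split=> // z' Xz'.
have Xz t : X i (z t) by case: (hz t).
have FF' : Filter F by exact: filter_filter.
have c1 := mean_cost_cvg (i := i) FF' (deviate_profile Xa Xz0)
  (fun t => deviate_profile (Xh t) (Xz t)) (deviate_cvg FF' ha zz0) hm.
have c2 := mean_cost_cvg (i := i) FF' (deviate_profile Xa Xz')
  (fun t => deviate_profile (Xh t) Xz') (deviate_cvg FF' ha (@cvg_cst _ z' _ F FF')) hm.
exact: cvg_le_cvg c1 c2 (fun t => (hz t).2 z' Xz').
Qed.

(** Compactness of the strategy set and uniqueness of the best response turn the
closed graph into convergence. *)
Lemma best_response_cvg T (F : set_system T) i (h : T -> profile R n) a
    (m : T -> Theta -> R) m0 (z : T -> 'rV[R]_(n i)) z0 :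
  ProperFilter F -> is_belief m0 -> profiles X a -> (forall t, profiles X (h t)) ->
  (forall j, h t j @[t --> F] --> a j) ->
  (forall th, m t th @[t --> F] --> m0 th) ->
  (forall t, best_response X u i (h t) (m t) (z t)) ->
  best_response X u i a m0 z0 -> z @ F --> z0.
Proof.
move=> FF bm Xa Xh ha hm hz hz0 U Uz0; apply: contrapT => nFU.
pose G := within (~` (z @^-1` U)) F.
have PG : ProperFilter G.
  split; last exact: within_filter.
  move=> G0; apply: nFU; suff : F (z @^-1` U) by [].
  have {}G0 : F [set t | ~ U (z t) -> False] := G0.
  by apply: (filterS _ G0) => t nU; apply: contrapT => /nU.
have [H [UH GH]] := ultraFilterLemma PG.
have FH : F `<=` H.
  move=> B FB; apply: GH; suff : F [set t | ~ U (z t) -> B t] by [].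
  by apply: (filterS _ FB) => t Bt _.
have PH : ProperFilter H by exact: ultra_proper.
have zH : H (z @^-1` X i) by apply: (filterE (F := H)) => t; case: (hz t).
have [_] := hX i; rewrite compact_ultra => /(_ (z @ H) (fmap_ultra z UH) zH)[p [Xp zp]].
have hp : best_response X u i a m0 p.
  apply: (best_response_closed (F := H) _ Xa Xh _ _ hz zp Xp).
  - by move=> j; apply: cvg_trans (ha j); exact: cvg_app.
  - by move=> th; apply: cvg_trans (hm th); exact: cvg_app.
rewrite (best_response_unique bm Xa hp hz0) in zp.
have HU : H (z @^-1` U) := zp _ Uz0.
have HnU : H (~` (z @^-1` U)) by apply: GH; exact: withinT.
by have [t []] := filter_ex (filterI HU HnU).
Qed.

(** The same continuity in a form that applies to many steps of a process at once. *)
Lemma best_response_modulus i a m0 (z0 : 'rV[R]_(n i)) (eta : R) :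
  is_belief m0 -> profiles X a -> best_response X u i a m0 z0 -> 0 < eta ->
  exists2 e : R, 0 < e & forall x m z, profiles X x ->
    (forall j, `|a j - x j| < e) -> (forall th, `|m0 th - m th| < e) ->
    best_response X u i x m z -> `|z0 - z| < eta.
Proof.
move=> bm Xa hz0 eta0; apply: contrapT => nex.
have ex k : exists p : profile R n * (Theta -> R) * 'rV[R]_(n i),
    [/\ profiles X p.1.1, forall j, `|a j - p.1.1 j| < k.+1%:R^-1,
        forall th, `|m0 th - p.1.2 th| < k.+1%:R^-1,
        best_response X u i p.1.1 p.1.2 p.2 & eta <= `|z0 - p.2|].
  apply: contrapT => np; apply: nex; exists k.+1%:R^-1; first by rewrite invr_gt0.
  move=> x m z Xx ax mm bz; rewrite ltNge; apply/negP => ez; apply: np.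
  by exists (x, m, z).
have [p pP] := choice ex.
have : (fun k => (p k).2) @ \oo --> z0.
  apply: (best_response_cvg (h := fun k => (p k).1.1) (a := a)
    (m := fun k => (p k).1.2) (m0 := m0)) => //.
  - by move=> k; case: (pP k).
  - by move=> j; apply: cvg_harmonic_dist => k; case: (pP k) => _ pj _ _ _; exact: pj.
  - move=> th; apply: (cvg_harmonic_dist (V := R^o)) => k; case: (pP k) => _ _ pth _ _; exact: pth.
  - by move=> k; case: (pP k).
move/cvgrPdist_lt/(_ eta eta0) => [k _ /(_ k (leqnn k))].
by rewrite /= ltNge; case: (pP k) => _ _ _ _ ->.
Qed.

End best_responses.

(** * Occupation averages along the best-response dynamics *)

Section step_clock.
Context {R : realType}.
Variable alpha : nat -> R.
Hypothesis alpha_gt0 : forall t, 0 < alpha t.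
Hypothesis clock_oo : clock alpha @ \oo --> +oo.
Local Notation S := (clock alpha).

Lemma clock0 : S 0%N = 0. Proof. by rewrite /clock big_nil. Qed.

Lemma clock_lt s t : (s < t)%N = (S s < S t).
Proof.
have Slt i j : (i < j)%N -> S i < S j.
  elim: j => // j IH; rewrite ltnS leq_eqVlt => /predU1P[->|/IH ij].
    by rewrite clockS ltrDl.
  by apply: (lt_trans ij); rewrite clockS ltrDl.
apply/idP/idP; first exact: Slt.
by apply: contraTT; rewrite -leqNgt -leNgt leq_eqVlt => /predU1P[->//|/Slt/ltW].
Qed.

Lemma clock_le s t : (s <= t)%N = (S s <= S t).
Proof. by rewrite leqNgt clock_lt -leNgt. Qed.

(** A step of the learning process is an Euler step of the dynamics with the step size
as time increment; [idx] translates times of the dynamics into steps. *)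
Lemma clock_inverse : exists idx : R -> nat, forall r, 0 <= r ->
  S (idx r) <= r < S (idx r).+1.
Proof.
suff ex r : exists j, 0 <= r -> S j <= r < S j.+1 by have [idx] := choice ex; exists idx.
have [r0|r0] := leP 0 r; last by exists 0%N.
have [M _ /(_ M (leqnn M)) SM] : \forall M \near \oo, r < S M.
  by move/cvgryPgt: clock_oo; exact.
elim: M SM => [|M IH] SM; first by move: SM; rewrite clock0 ltNge r0.
by have [/IH//|rM] := ltP r (S M); exists M; rewrite rM SM.
Qed.

Lemma clockB_sum s t : (s <= t)%N -> S t - S s = \sum_(s <= j < t) alpha j.
Proof.
move=> st; have -> : S t = S s + \sum_(s <= j < t) alpha j.
  by rewrite /clock -big_cat_nat.
by rewrite addrAC subrr add0r.
Qed.

End step_clock.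

Section limiting_averages.
Context {R : realType} {N : nat} {n : 'I_N -> nat} {Theta : finType}.
Variables (X : forall i : 'I_N, set 'rV[R]_(n i)).
Arguments X : clear implicits.
Variables (u : 'I_N -> profile R n -> Theta -> R).
Hypothesis hX : forall i, convex_set (X i) /\ compact (X i).
Hypothesis hu : forall i th, {within profiles X, continuous (fun x0 => u i x0 th)} /\
  strictly_convex_own X i (fun x0 => u i x0 th).
Variables (alpha : nat -> R) (xs : nat -> profile R n)
  (zs : nat -> forall i : 'I_N, 'rV[R]_(n i)) (m : nat -> 'I_N -> Theta -> R)
  (mu : Theta -> R).
Hypothesis alpha01 : forall t, 0 < alpha t < 1.
Hypothesis alpha_cvg0 : alpha @ \oo --> 0.
Hypothesis clock_oo : clock alpha @ \oo --> +oo.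
Hypothesis xs_in : forall t, profiles X (xs t).
Hypothesis zs_best : forall t i, best_response X u i (xs t) (m t i) (zs t i).
Hypothesis xsS : forall t i, xs t.+1 i = (1 - alpha t) *: xs t i + alpha t *: zs t i.
Hypothesis mu_belief : is_belief mu.
Hypothesis m_cvg : forall i th, m t i th @[t --> \oo] --> mu th.
Arguments m_cvg : clear implicits.
Local Notation S := (clock alpha).

Let alpha_gt0 t : 0 < alpha t. Proof. by case/andP: (alpha01 t). Qed.

Lemma strategy_bound : exists2 K : R, 0 < K & forall i z, X i z -> `|z| <= K.
Proof.
have ex i : exists K : R, forall z, X i z -> `|z| <= K.
  have [_ /compact_bounded [K [_ KX]]] := hX i.
  by exists (K + 1) => z Xz; apply: KX Xz; rewrite ltrDl.
have [K KP] := choice ex; exists (1 + \sum_i `|K i|).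
  by rewrite ltr_pwDl // sumr_ge0.
move=> i z /KP zK; apply: (le_trans zK); apply: (le_trans (ler_norm _)).
by rewrite (bigD1 i) //= addrCA lerDl addr_ge0 // sumr_ge0.
Qed.

Section bounded_clock.
Variables (K : R).
Hypothesis K_gt0 : 0 < K.
Hypothesis XK : forall i z, X i z -> `|z| <= K.

Lemma xs_increment t i : xs t.+1 i - xs t i = alpha t *: (zs t i - xs t i).
Proof. by rewrite xsS; apply/rowP => k; rewrite !mxE; ring. Qed.

Lemma xs_lipschitz s t i : `|xs s i - xs t i| <= 2 * K * `|S s - S t|.
Proof.
wlog st : s t / (s <= t)%N.
  by case/orP: (leq_total s t) => ? H; [|rewrite distrC (distrC (S s))]; exact: H.
rewrite (distrC (S s)) [X in _ * X]ger0_norm ?subr_ge0 -?(clock_le alpha_gt0) // distrC.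
elim: t st => [|t IH]; first by rewrite leqn0 => /eqP ->; rewrite !subrr normr0 mulr0.
rewrite leq_eqVlt => /predU1P[->|/IH{}IH]; first by rewrite !subrr normr0 mulr0.
rewrite clockS -(subrK (xs t i) (xs t.+1 i)) -addrA.
apply: (le_trans (ler_normD _ _)).
have -> : 2 * K * (S t + alpha t - S s) = alpha t * (K + K) + 2 * K * (S t - S s) by ring.
rewrite lerD // xs_increment normrZ gtr0_norm // ler_pM2l //.
apply: (le_trans (ler_normB _ _)); rewrite lerD ?XK //; last exact: xs_in.
by case: (zs_best t i).
Qed.

(** Euler steps with nearly constant velocity [z - a] add up to a nearly linear motion
in clock time. *)
Lemma xs_drift s t i (a z : 'rV[R]_(n i)) (eta : R) : (s <= t)%N ->
  (forall j, (s <= j < t)%N -> `|zs j i - z| <= eta /\ `|xs j i - a| <= eta) ->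
  `|xs t i - xs s i - (S t - S s) *: (z - a)| <= 2 * eta * (S t - S s).
Proof.
elim: t => [|t IH]; first by rewrite leqn0 => /eqP -> _; rewrite !subrr scale0r subrr normr0 mulr0.
rewrite leq_eqVlt => /predU1P[-> _|st near].
  by rewrite !subrr scale0r subrr normr0 mulr0.
rewrite clockS -(subrK (xs t i) (xs t.+1 i)) xs_increment.
have [zt xt] : `|zs t i - z| <= eta /\ `|xs t i - a| <= eta.
  by apply: near; rewrite ltnSn andbT -ltnS.
have -> : alpha t *: (zs t i - xs t i) + xs t i - xs s i
    - (S t + alpha t - S s) *: (z - a)
  = alpha t *: ((zs t i - z) - (xs t i - a))
    + (xs t i - xs s i - (S t - S s) *: (z - a)).
  by apply/rowP => k; rewrite !mxE; ring.
apply: (le_trans (ler_normD _ _)).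
have -> : 2 * eta * (S t + alpha t - S s) = alpha t * (eta + eta) + 2 * eta * (S t - S s).
  by ring.
rewrite lerD //; last by apply: IH => // j /andP[sj jt]; apply: near; rewrite sj ltnW.
by rewrite normrZ gtr0_norm // ler_pM2l // (le_trans (ler_normB _ _)) // lerD.
Qed.

Variable idx : R -> nat.
Hypothesis idxP : forall r, 0 <= r -> S (idx r) <= r < S (idx r).+1.

Lemma idx_clock t : idx (S t) = t.
Proof.
have /idxP : 0 <= S t by rewrite -(clock0 alpha) -(clock_le alpha_gt0).
by rewrite -(clock_le alpha_gt0) // -(clock_lt alpha_gt0) // ltnS -eqn_leq => /eqP.
Qed.

Lemma idx_ge M r : S M <= r -> (M <= idx r)%N.
Proof.
move=> Mr; have /idxP/andP[_ rlt] : 0 <= r.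
  by apply: le_trans Mr; rewrite -(clock0 alpha) -(clock_le alpha_gt0).
by rewrite -ltnS (clock_lt alpha_gt0) //; exact: le_lt_trans rlt.
Qed.

Lemma idx_mono r r' : 0 <= r -> r <= r' -> (idx r <= idx r')%N.
Proof. by move=> r0 rr; apply: idx_ge; apply: le_trans rr; case/andP: (idxP r0). Qed.

Section windows.
Variable base : nat -> nat.
Hypothesis base_ge : forall k, (k <= base k)%N.
Variable U : set_system nat.
Hypothesis UU : UltraFilter U.
Hypothesis U_oo : \oo `<=` U.
#[local] Instance PU : ProperFilter U. Proof. exact: ultra_proper. Qed.

(** The trajectory seen from step [base k] on, in clock time. Limits over the windows
are taken along one ultrafilter [U], so that they exist at all clock times at once
without extraction of subsequences. *)
Definition window (k : nat) (r : R) : nat := idx (S (base k) + r).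

Lemma near_clock_base A : \forall k \near U, A <= S (base k).
Proof.
have : \forall k \near \oo, A <= S k by move/cvgryPge: clock_oo; exact.
move=> /U_oo; apply: filterS => k /le_trans; apply.
by rewrite -(clock_le alpha_gt0).
Qed.

Lemma near_window_ge M r : \forall k \near U, forall r', r <= r' ->
  0 <= S (base k) + r' /\ (M <= window k r')%N.
Proof.
have := near_clock_base (S M - r); apply: filterS => k Mk r' rr'.
have SMr : S M <= S (base k) + r' by lra.
split; last exact: idx_ge.
by apply: le_trans SMr; rewrite -(clock0 alpha) -(clock_le alpha_gt0).
Qed.

Lemma near_window_clock r e : 0 < e -> \forall k \near U, forall r', r <= r' ->
  `|S (window k r') - S (base k) - r'| <= e.
Proof.
move=> e0; have [M _ Me] : \forall t \near \oo, `|alpha t| < e.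
  by move/cvgr0Pnorm_lt: alpha_cvg0; exact.
have := near_window_ge M r; apply: filterS => k Mk r' /Mk[r'0 Mw].
have := Me _ Mw; rewrite gtr0_norm //= => ae.
have := idxP r'0; rewrite -/(window k r') clockS ler_norml.
move: (S (window k r')) => s; lra.
Qed.

Lemma window_clock_cvg r : S (window k r) - S (base k) @[k --> U] --> r.
Proof.
apply/cvgrPdist_le => e e0; have := near_window_clock r e0.
by apply: filterS => k /(_ r (lexx r)); rewrite distrC.
Qed.

Variable xi : R -> profile R n.
Hypothesis xiP : forall r i, xs (window k r) i @[k --> U] --> xi r i.
Arguments xiP : clear implicits.

Lemma xi_in r : profiles X (xi r).
Proof.
move=> i; have [_ cX] := hX i.
have clX : closed (X i) by apply: compact_closed cX; exact: norm_hausdorff.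
have inX : \forall k \near U, X i (xs (window k r) i) by apply: nearW => k; exact: xs_in.
exact: (closed_cvg _ clX inX _ (xiP r i)).
Qed.

Lemma lim_norm_le (V : normedModType R) (h : nat -> V) (a : V) (b : nat -> R) b0 :
  h @ U --> a -> b @ U --> b0 -> (\forall k \near U, `|h k| <= b k) -> `|a| <= b0.
Proof.
move=> ha bb hb; rewrite -subr_ge0; apply: (cvgr_to_ge (cvgB bb (cvg_norm ha))).
by apply: filterS hb => k; rewrite subr_ge0.
Qed.

Lemma xi_lipschitz r r' i : `|xi r i - xi r' i| <= 2 * K * `|r - r'|.
Proof.
apply: (lim_norm_le (cvgB (xiP r i) (xiP r' i))).
  apply: cvgM; first exact: cvg_cst.
  by apply: cvg_norm; apply: cvgB; exact: window_clock_cvg.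
apply: nearW => k /=; rewrite [X in _ * `|X|](_ : _ = S (window k r) - S (window k r')).
  exact: xs_lipschitz.
by rewrite opprB addrA subrK.
Qed.

(** Best responses at the states visited near clock time [r] of a late window
are near the best response to the limiting state, so that the limit has the
derivative prescribed by the dynamics. *)
Lemma xi_drift r i z eta : best_response X u i (xi r) mu z -> 0 < eta ->
  exists2 d : R, 0 < d & forall r1 r2, r - d <= r1 -> r1 <= r2 -> r2 <= r + d ->
    `|xi r2 i - xi r1 i - (r2 - r1) *: (z - xi r i)| <= 2 * eta * (r2 - r1).
Proof.
move=> bz eta0.
have [e e0 eP] := best_response_modulus hX hu mu_belief (xi_in r) bz eta0.
pose e' := Num.min e eta; have e'0 : 0 < e' by rewrite lt_min e0.
(* a clock error of [3 d] moves the state by at most [2 K * 3 d = e' / 2] *)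
pose d := e' / (12 * K); have d0 : 0 < d by rewrite divr_gt0 // mulr_gt0.
have dK : 6 * K * d = e' / 2 by rewrite /d; field; rewrite gt_eqF.
exists d => // r1 r2 rr1 r12 r2r.
have [M _ Mm] : \forall t \near \oo, forall th, `|mu th - m t i th| < e.
  by apply: filter_forall => th; move/cvgrPdist_lt: (m_cvg i th); apply.
apply: (@lim_norm_le _ (fun k => xs (window k r2) i - xs (window k r1) i
    - ((S (window k r2) - S (base k)) - (S (window k r1) - S (base k)))
      *: (z - xi r i)) _
  (fun k => 2 * eta *
    ((S (window k r2) - S (base k)) - (S (window k r1) - S (base k))))).
- apply: cvgB; first by apply: cvgB; exact: xiP.
  by apply: cvgZr_tmp; apply: cvgB; exact: window_clock_cvg.
- by apply: cvgMl_tmp; apply: cvgB; exact: window_clock_cvg.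
have near_xi : \forall k \near U, forall j, `|xi r j - xs (window k r) j| < e' / 2.
  apply: filter_forall => j; move/cvgrPdist_lt: (xiP r j); apply.
  by rewrite divr_gt0.
move: near_xi (near_window_clock (r - d) d0) (near_window_ge M (r - d)).
apply: filterS3 => k kxi kclock kM.
rewrite [X in X *: _](_ : _ = S (window k r2) - S (window k r1)); last first.
  by rewrite opprB addrA subrK.
rewrite [X in _ <= _ * X](_ : _ = S (window k r2) - S (window k r1)); last first.
  by rewrite opprB addrA subrK.
apply: xs_drift; first by apply: idx_mono; [have [] := kM _ rr1|rewrite lerD2l].
move=> s /andP[s1 s2].
have Ms : (M <= s)%N by apply: leq_trans s1; have [] := kM _ rr1.
have clk1 := kclock _ rr1.
have clk2 := kclock _ (le_trans rr1 r12).
have clk : `|S (window k r) - S (base k) - r| <= d by apply: kclock; lra.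
have xis j : `|xi r j - xs s j| < e'.
  rewrite -(subrK (xs (window k r) j) (xi r j)) -addrA.
  apply: (le_lt_trans (ler_normD _ _)).
  have -> : e' = e' / 2 + 6 * K * d by rewrite dK; field.
  rewrite ltr_leD // (le_trans (xs_lipschitz _ _ _)) //.
  have -> : 6 * K * d = 2 * K * (3 * d) by ring.
  rewrite ler_pM2l ?mulr_gt0 //.
  move: s1 s2; rewrite (clock_le alpha_gt0) => s1 /ltnW; rewrite (clock_le alpha_gt0) => s2.
  move: clk1 clk2 clk s1 s2; rewrite !ler_norml.
  move: (S (window k r)) (S (window k r1)) (S (window k r2)) (S s) (S (base k)) => *; lra.
have e'e : e' <= e by rewrite ge_min lexx.
have e'eta : e' <= eta by rewrite ge_min lexx orbT.
split; last by rewrite distrC ltW // (lt_le_trans (xis i)).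
rewrite distrC ltW //; apply: (eP (xs s) (m s i)).
- exact: xs_in.
- by move=> j; exact: lt_le_trans (xis j) e'e.
- exact: Mm.
- exact: zs_best.
Qed.

Lemma xi_best r i : exists z, best_response X u i (xi r) mu z.
Proof.
have zX k : X i (zs (window k r) i) by case: (zs_best (window k r) i).
have [_] := hX i; rewrite compact_ultra.
have zH : U ((fun k => zs (window k r) i) @^-1` X i) by apply: (filterE (F := U)).
move=> /(_ _ (fmap_ultra (fun k => zs (window k r) i) UU) zH)[z [Xz zz]].
exists z.
apply: (best_response_closed hu PU (xi_in r) (fun k => xs_in (window k r)) (xiP r)
  _ (fun k => zs_best (window k r) i) zz Xz).
move=> th; apply/cvgrPdist_lt => e e0.
have [M _ Mm] : \forall t \near \oo, `|mu th - m t i th| < e.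
  by move/cvgrPdist_lt: (m_cvg i th); apply.
have := near_window_ge M r; apply: filterS => k /(_ r (lexx r))[_]; exact: Mm.
Qed.

(** [xi_drift] is the differentiability of the limit, with the velocity prescribed by the
best responses: a window limit is a classical solution. *)
Lemma xi_dynamics : best_response_dynamics X u mu (xi 0) xi.
Proof.
split=> //.
- by move=> t _; exact: xi_in.
- apply: continuous_subspaceT => r; apply: cvg_profile => i.
  apply/cvgrPdist_le => e e0.
  have eK : 0 < e / (2 * K) by rewrite divr_gt0 // mulr_gt0.
  have /cvgrPdist_le/(_ _ eK) : id r' @[r' --> r] --> r by [].
  apply: filterS => r' rr'; apply: (le_trans (xi_lipschitz _ _ _)).
  by rewrite mulrC -ler_pdivlMr ?mulr_gt0.
move=> r _ i; have [z bz] := xi_best r i; exists z => //.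
suff drv : h^-1 *: (xi (h *: (1 : R) + r) i - xi r i) @[h --> (0 : R)^'] --> z - xi r i.
  have := @derivableP R R 'rV[R]_(n i) (fun s => xi s i) r 1 (cvgP _ drv).
  by rewrite [X in is_derive _ _ _ X](cvg_lim _ drv).
apply/cvgrPdist_le => e e0.
have e20 : 0 < e / 2 by rewrite divr_gt0.
have [d d0 dP] := xi_drift bz e20.
near=> h.
have h0 : h != 0 by near: h; exact: nbhs_dnbhs_neq.
have hd : `|h| <= d.
  by near: h; apply: dnbhs0_le.
rewrite /GRing.scale /= mulr1 distrC.
rewrite -(@ler_pM2l _ `|h|) ?normr_gt0 // -normrZ scalerBr scalerA mulfV // scale1r.
have -> : `|h| * e = 2 * (e / 2) * `|h| by field.
move: hd; rewrite ler_norml => /andP[hd1 hd2].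
have [h_ge0|h_lt0] := leP 0 h.
  have := dP r (h + r); rewrite addrK ger0_norm //; apply; lra.
have := dP (h + r) r; rewrite ltr0_norm //.
have -> : r - (h + r) = - h by ring.
rewrite -normrN => bnd.
have -> : xi (h + r) i - xi r i - h *: (z - xi r i)
    = - (xi r i - xi (h + r) i - - h *: (z - xi r i)).
  by apply/rowP => k; rewrite !mxE; ring.
apply: bnd; lra.
Unshelve. all: by end_near. Qed.

(** A solution that converges to [xst] spends all but a bounded time where [g]
is small, and on compact time intervals late windows shadow it. *)
Lemma window_average (g : profile R n -> R) (xst : profile R n) (G eps : R) :
  {within profiles X, continuous g} -> profiles X xst ->
  (forall p, profiles X p -> 0 <= g p <= G) -> g xst = 0 ->
  xi r @[r --> +oo] --> xst -> 0 < eps ->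
  exists r1, \forall k \near U, [/\ (base k < window k r1)%N,
    S (window k r1) - S (base k) <= r1 &
    \sum_(base k <= s < window k r1) alpha s * g (xs s)
      <= eps * (S (window k r1) - S (base k))].
Proof.
move=> gc Xxst gG g0 xi_cvg eps0.
have G0 : 0 <= G by have /andP[/le_trans] := gG _ Xxst; apply.
have [r0 r0_gt0 small] : exists2 r0, 0 < r0 & forall r, r0 <= r -> g (xi r) < eps / 4.
  have : g (xi r) @[r --> +oo] --> g xst.
    by apply: (cvg_within_profile _ gc Xxst xi_in) => i; exact: cvg_coordinate.
  have eps40 : 0 < eps / 4 by rewrite divr_gt0.
  rewrite g0 => /cvgr0Pnorm_lt/(_ _ eps40)[M [_ MP]].
  exists (1 + `|M|); first by rewrite ltr_pwDl.
  move=> r Mr; apply: (le_lt_trans (ler_norm _)); apply: MP.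
  by apply: (le_lt_trans (ler_norm _)); lra.
(* long enough to absorb the contribution, at most [G * (r0 + 1)], of times up to [r0] *)
pose r1 := r0 + 2 + 2 * G * (r0 + 1) / eps.
have r01 : r0 + 2 <= r1 by rewrite lerDl !mulr_ge0 ?invr_ge0 // ltW // ltr_pwDl.
have shadow : \forall k \near U, forall r, r0 <= r <= r1 -> g (xs (window k r)) < eps / 2.
  have /compact_near_coveringP cov := @segment_compact R r0 r1.
  suff : \forall k \near U, `[r0, r1] `<=` [set r | g (xs (window k r)) < eps / 2].
    by apply: filterS => k sub r rr; apply: sub; rewrite /= in_itv.
  apply: cov => r /=; rewrite in_itv /= => /andP[r0r rr1].
  have eps40 : 0 < eps / 4 by rewrite divr_gt0.
  have [e e0 eP] := within_continuous_box gc (xi_in r) eps40.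
  (* as in [xi_drift], a clock error of [3 d] moves the state by at most [e / 2] *)
  pose d := e / (12 * K); have d0 : 0 < d by rewrite divr_gt0 // mulr_gt0.
  have near_xi : \forall k \near U, forall j, `|xi r j - xs (window k r) j| < e / 2.
    apply: filter_forall => j; move/cvgrPdist_lt: (xiP r j); apply.
    by rewrite divr_gt0.
  exists ([set r' | `|r - r'| < d],
          [set k | (forall j, `|xi r j - xs (window k r) j| < e / 2) /\
            forall r', r - d <= r' -> `|S (window k r') - S (base k) - r'| <= d]).
    split => /=; last by have := near_window_clock (r - d) d0; exact: filterS2 near_xi.
    by have /cvgrPdist_lt/(_ _ d0) : id r' @[r' --> r] --> r by [].
  move=> [r' k] /= [rr' [kxi kclock]].
  suff : `|g (xi r) - g (xs (window k r'))| < eps / 4.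
    have := small r r0r; rewrite ltr_norml; lra.
  apply: eP; first exact: xs_in.
  move=> j; rewrite -(subrK (xs (window k r) j) (xi r j)) -addrA.
  apply: (le_lt_trans (ler_normD _ _)).
  have -> : e = e / 2 + 2 * K * (3 * d) by rewrite /d; field; rewrite gt_eqF.
  rewrite ltr_leD // (le_trans (xs_lipschitz _ _ _)) // ler_pM2l ?mulr_gt0 //.
  have := kclock r; have := kclock r'; move: rr'; rewrite ltr_norml !ler_norml.
  move: (S (window k r)) (S (window k r')) (S (base k)) => a b c rr' h1 h2.
  have := h1 _; have := h2 _; lra.
exists r1; have := near_window_clock r0 ltr01.
move: shadow; apply: filterS2 => k shadow kclock.
have Sb0 : 0 <= S (base k) by rewrite -(clock0 alpha) -(clock_le alpha_gt0).
have win r : 0 <= r -> S (window k r) <= S (base k) + r < S (window k r).+1.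
  by move=> r_ge0; apply: idxP; rewrite addr_ge0.
have r1_ge0 : 0 <= r1 by lra.
have clk1 := kclock r1 _; have w1 := win _ r1_ge0; have w0 := win _ (ltW r0_gt0).
have L1 : r1 - 1 <= S (window k r1) - S (base k).
  by move: (clk1 ltac:(lra)); rewrite ler_norml; lra.
have bw : (base k < window k r1)%N by rewrite (clock_lt alpha_gt0) -subr_gt0; lra.
split=> //; first by lra.
have b0 : (base k <= (window k r0).+1)%N.
  by rewrite (clock_le alpha_gt0); lra.
have w01 : ((window k r0).+1 <= window k r1)%N.
  rewrite (clock_lt alpha_gt0) -/(S _); move: (clk1 ltac:(lra)); rewrite ler_norml; lra.
have a1 := alpha01 (window k r0).
have gs s : 0 <= g (xs s) <= G by apply: gG; exact: xs_in.
rewrite (big_cat_nat b0 w01) /=.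
apply: (@le_trans _ _ (G * (r0 + 1) + eps / 2 * (S (window k r1) - S (base k)))).
  apply: lerD.
    apply: (@le_trans _ _ (\sum_(base k <= s < (window k r0).+1) G * alpha s)).
      by apply: ler_sum => s _; rewrite mulrC ler_pM2r //; case/andP: (gs s).
    rewrite -mulr_sumr -clockB_sum // ler_wpM2l // clockS; lra.
  apply: (@le_trans _ _ (\sum_((window k r0).+1 <= s < window k r1) eps / 2 * alpha s)).
    apply: ler_sum_nat => s /andP[s0 s1]; rewrite mulrC ler_pM2r // ltW //.
    have -> : s = window k (S s - S (base k)) by rewrite /window addrCA subrr addr0 idx_clock.
    apply: shadow; move: s0 (ltnW s1); rewrite !(clock_le alpha_gt0); lra.
  rewrite -mulr_sumr -clockB_sum // ler_pM2l ?divr_gt0 // lerB //.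
  by rewrite -(clock_le alpha_gt0).
rewrite -lerBrDr -mulrBl; have -> : eps - eps / 2 = eps / 2 by field.
apply: (@le_trans _ _ (eps / 2 * (r1 - 1))); last by rewrite ler_pM2l ?divr_gt0.
have -> : eps / 2 * (r1 - 1) = eps / 2 * (r0 + 1) + G * (r0 + 1).
  by rewrite /r1; field; rewrite gt_eqF.
by rewrite lerDr mulr_ge0 ?addr_ge0 ?divr_ge0 // ltW.
Qed.
End windows.
End bounded_clock.

Variable xst : profile R n.
Hypothesis Xxst : profiles X xst.
Hypothesis dynamics_cvg : forall x0, profiles X x0 -> forall xb : R -> profile R n,
  best_response_dynamics X u mu x0 xb -> xb t @[t --> +oo] --> xst.
Variables (g : profile R n -> R) (G : R).
Hypothesis g_cont : {within profiles X, continuous g}.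
Hypothesis g_bound : forall p, profiles X p -> 0 <= g p <= G.
Hypothesis g_xst : g xst = 0.

(** Otherwise there would be windows of every length, starting arbitrarily late, along
which all averages exceed [eps]; their limit would be a solution, and it converges to
[xst], which [window_average] excludes. The compactness in this argument makes up for
the lack of a common speed of convergence of the solutions. *)
Lemma short_good_windows eps : 0 < eps -> exists (L : R) (t0 : nat),
  forall t, (t0 <= t)%N -> exists t', [/\ (t < t')%N, S t' - S t <= L &
    \sum_(t <= s < t') alpha s * g (xs s) <= eps * (S t' - S t)].
Proof.
move=> eps0; apply: contrapT => nowin.
have [K K0 XK] := strategy_bound.
have [idx idxP] := clock_inverse clock_oo.
have ex k : exists t, (k <= t)%N /\ forall t', ~ [/\ (t < t')%N, S t' - S t <= k%:R &
    \sum_(t <= s < t') alpha s * g (xs s) <= eps * (S t' - S t)].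
  apply: contrapT => nt; apply: nowin; exists k%:R, k => t kt.
  by apply: contrapT => nt'; apply: nt; exists t; split=> // t' bad; apply: nt'; exists t'.
have [base baseP] := choice ex.
have base_ge k : (k <= base k)%N by case: (baseP k).
have [U [UU ooU]] := ultraFilterLemma (F := \oo%classic) _.
pose xi r : profile R n := fun i => lim (xs (window idx base k r) i @[k --> U]).
have xiP r i : xs (window idx base k r) i @[k --> U] --> xi r i.
  have [_] := hX i; rewrite compact_ultra.
  have zH : U ((fun k => xs (window idx base k r) i) @^-1` X i).
    by apply: (filterE (F := U)) => k; exact: xs_in.
  move=> /(_ _ (fmap_ultra (fun k => xs (window idx base k r) i) UU) zH)[z [_ zz]].
  exact: (cvgP _ zz).
have xi_cvg : xi r @[r --> +oo] --> xst.
  apply: (dynamics_cvg (x0 := xi 0)); first exact: (xi_in UU xiP).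
  exact: (xi_dynamics K0 XK idxP base_ge UU ooU xiP).
have [r1 win] := window_average K0 XK idxP base_ge UU ooU xiP g_cont Xxst g_bound g_xst
  xi_cvg eps0.
have big : \forall k \near U, r1 <= k%:R.
  apply: ooU; exact: nbhs_infty_ger.
have [k [[lt len avg] r1k]] := filter_ex (filterI win big).
by case: (baseP k) => _ /(_ (window idx base k r1)); apply; split=> //; exact: le_trans r1k.
Qed.

(** Good windows of bounded length tile late clock time. This gives convergence of
averages only: [xst] may attract all solutions without being stable, and then the
trajectory itself may leave it again and again. *)
Lemma clock_average_cvg0 :
  (\sum_(0 <= t < T) alpha t * g (xs t)) / S T @[T --> \oo] --> 0.
Proof.
pose A s t := \sum_(s <= j < t) alpha j * g (xs j).
have gs s : 0 <= g (xs s) <= G by apply: g_bound; exact: xs_in.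
have G0 : 0 <= G by have /andP[/le_trans] := gs 0%N; apply.
have A_ge0 s t : 0 <= A s t.
  rewrite sumr_ge0 // => j _; apply: mulr_ge0; first exact: ltW.
  by case/andP: (gs j).
have A_le s t : (s <= t)%N -> A s t <= G * (S t - S s).
  move=> st; rewrite clockB_sum // mulr_sumr; apply: ler_sum => j _.
  by rewrite mulrC ler_pM2r //; case/andP: (gs j).
apply/cvgr0Pnorm_lt => eps eps0.
have e20 : 0 < eps / 2 by rewrite divr_gt0.
have [L [t0 good]] := short_good_windows e20.
have L0 : 0 <= L.
  have [t' [tt' + _]] := good t0 (leqnn _); apply: le_trans.
  by rewrite subr_ge0 -(clock_le alpha_gt0) ltnW.
have chain T t : (t0 <= t)%N -> (t <= T)%N -> A t T <= eps / 2 * (S T - S t) + G * L.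
  move=> t0t tT; have [w] := ubnP (T - t); elim: w t t0t tT => // w IH t t0t tT Tw.
  have [t' [tt' len avg]] := good t t0t.
  have [Tt'|t'T] := leqP T t'.
    apply: (le_trans (A_le _ _ tT)); rewrite ler_wpDl //.
      by rewrite mulr_ge0 ?subr_ge0 -?(clock_le alpha_gt0) // ltW.
    rewrite ler_wpM2l //; apply: le_trans len.
    by rewrite lerD2r -(clock_le alpha_gt0).
  have -> : A t T = A t t' + A t' T by rewrite /A -big_cat_nat // ltnW.
  have -> : eps / 2 * (S T - S t) + G * L =
    eps / 2 * (S t' - S t) + (eps / 2 * (S T - S t') + G * L) by ring.
  apply: lerD => //; apply: IH; [exact: leq_trans (ltnW tt')|exact: ltnW|].
  by rewrite -ltnS; apply: leq_trans Tw; rewrite ltnS ltn_sub2l // (ltn_trans tt').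
pose B := G * S t0 + G * L.
have near_T : \forall T \near \oo, [/\ (t0 <= T)%N, 0 < S T & `|B / S T| < eps / 2].
  near=> T; split.
  - by near: T; exists t0.
  - by near: T; move/cvgryPgt: clock_oo; apply.
  - by near: T; have /cvgr0Pnorm_lt := bounded_over_diverging (fun _ => lexx `|B|) clock_oo; apply.
apply: filterS near_T => T [t0T ST small].
rewrite ger0_norm; last by rewrite divr_ge0 ?A_ge0 // ltW.
rewrite ltr_pdivrMr //.
have -> : \sum_(0 <= t < T) alpha t * g (xs t) = A 0%N t0 + A t0 T.
  by rewrite /A -big_cat_nat.
have b1 := A_le 0%N t0 (leq0n _); have b2 := chain T t0 (leqnn _) t0T.
rewrite clock0 subr0 in b1.
have b3 : B < eps / 2 * S T by rewrite -ltr_pdivrMr // (le_lt_trans (ler_norm _)).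
have b4 : eps / 2 * (S T - S t0) <= eps / 2 * S T.
  by rewrite ler_pM2l // gerBl -(clock0 alpha) -(clock_le alpha_gt0).
have -> : eps * S T = eps / 2 * S T + eps / 2 * S T by field.
rewrite /B in b3; lra.
Unshelve. all: by end_near. Qed.
End limiting_averages.

(** * Bounded measurable functions and their expectations *)

Section bounded_measurable.
Context {d : measure_display} {T : measurableType d} {R : realType}.
Implicit Types (f g : T -> R).

Definition bounded_measurable f :=
  measurable_fun setT f /\ exists K : R, forall t, `|f t| <= K.

Lemma bounded_measurable_cst (c : R) : bounded_measurable (fun=> c).
Proof. by split; [exact: measurable_cst|exists `|c|]. Qed.

Lemma bounded_measurable_indic (B : set T) :
  measurable B -> bounded_measurable (\1_B : T -> R).
Proof.
move=> mB; split; first exact: measurable_indic.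
by exists 1 => t; rewrite indicE ger0_norm // lern1; case: (_ \in _).
Qed.

Lemma bounded_measurableD f g : bounded_measurable f -> bounded_measurable g ->
  bounded_measurable (fun t => f t + g t).
Proof.
move=> [mf [K fK]] [mg [L gL]]; split; first exact: measurable_funD.
by exists (K + L) => t; rewrite (le_trans (ler_normD _ _)) // lerD.
Qed.

Lemma bounded_measurableM f g : bounded_measurable f -> bounded_measurable g ->
  bounded_measurable (fun t => f t * g t).
Proof.
move=> [mf [K fK]] [mg [L gL]]; split; first exact: measurable_funM.
by exists (K * L) => t; rewrite normrM ler_pM.
Qed.

Lemma bounded_measurableB f g : bounded_measurable f -> bounded_measurable g ->
  bounded_measurable (fun t => f t - g t).
Proof.
move=> [mf [K fK]] [mg [L gL]]; split; first exact: measurable_funB.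
by exists (K + L) => t; rewrite (le_trans (ler_normB _ _)) // lerD.
Qed.

Lemma bounded_measurable_sum (I : Type) (s : seq I) (F : I -> T -> R) :
  (forall i, bounded_measurable (F i)) ->
  bounded_measurable (fun t => \sum_(i <- s) F i t).
Proof.
move=> bF; elim: s => [|i s IH].
  under eq_fun do rewrite big_nil; exact: bounded_measurable_cst.
by under eq_fun do rewrite big_cons; exact: bounded_measurableD.
Qed.

(** Every bounded measurable function is within [e] of a combination of
indicators of its upper level sets [{f >= -K + i e}]. *)
Lemma bounded_measurable_ind (Q : (T -> R) -> Prop) :
  (forall B, measurable B -> Q \1_B) ->
  (forall c f g, bounded_measurable f -> bounded_measurable g -> Q f -> Q g ->
     Q (fun t => c * f t + g t)) ->
  (forall f, bounded_measurable f -> (forall e, 0 < e -> exists g,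
     [/\ bounded_measurable g, Q g & forall t, `|f t - g t| <= e]) -> Q f) ->
  forall f, bounded_measurable f -> Q f.
Proof.
move=> Qind Qlin Qlim f bf; have [mf [K fK]] := bf; apply: (Qlim f bf) => e e0.
pose B i := [set t | - K + i%:R * e <= f t].
have mB i : measurable (B i).
  rewrite -[B i]setTI; have -> : B i = f @^-1` `[- K + i%:R * e, +oo[%classic.
    by apply/seteqP; split=> t; rewrite /B /= in_itv /= andbT.
  by apply: mf => //; exact: measurable_itv.
pose h := fix h M : T -> R := if M is M'.+1
  then fun t => e * \1_(B M'.+1) t + h M' t
  else fun t => - K * \1_(setT : set T) t + \1_(set0 : set T) t.
have bh M : bounded_measurable (h M).
  elim: M => [|M IH] /=.
    apply: bounded_measurableD; last exact: bounded_measurable_indic.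
    apply: bounded_measurableM; first exact: bounded_measurable_cst.
    exact: bounded_measurable_indic.
  apply: bounded_measurableD => //.
  apply: bounded_measurableM; first exact: bounded_measurable_cst.
  exact: bounded_measurable_indic.
have Qh M : Q (h M).
  elim: M => [|M IH] /=; first by apply: Qlin; [exact: bounded_measurable_indic..| |]; exact: Qind.
  by apply: Qlin => //; [exact: bounded_measurable_indic|exact: Qind].
have h_spec M t : (- K + M%:R * e <= f t -> h M t = - K + M%:R * e) /\
    (f t < - K + M%:R * e -> h M t <= f t < h M t + e /\ h M t <= - K + M%:R * e).
  have f_ge : - K <= f t by move: (fK t); rewrite ler_norml => /andP[].
  elim: M => [|M [IH1 IH2]] /=.
    by rewrite indicT indic0 mulr1 addr0 mul0r addr0; split=> //; rewrite ltNge f_ge.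
  have E1 : M.+1%:R * e = M%:R * e + e by rewrite -natr1 mulrDl mul1r.
  split=> [ft|ft].
    rewrite indicE mem_set //= IH1; first by rewrite mulr1 E1; ring.
    by apply: le_trans ft; rewrite E1; lra.
  rewrite indicE memNset; last by rewrite /B /=; apply/negP; rewrite -ltNge.
  rewrite mulr0 add0r; have [/IH1 hE|/IH2[h1 h2]] := leP (- K + M%:R * e) (f t).
    by rewrite hE; move: ft; rewrite E1; lra.
  by split=> //; rewrite E1; lra.
have [M Mbig] : exists M : nat, K + K < M%:R * e.
  exists (Num.truncn ((K + K) / e)).+1; rewrite -ltr_pdivrMr //; exact: truncnS_gt.
exists (h M); split=> // t; have [_] := h_spec M t.
have f_le : f t <= K by move: (fK t); rewrite ler_norml => /andP[].
by case=> [|/andP[h1 h2] _]; [lra|rewrite ger0_norm; lra].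
Qed.
End bounded_measurable.

Section dominated.
Context {d : measure_display} {T : measurableType d} {R : realType}.

Lemma Rintegral_dominated_cvg (mu : {measure set T -> \bar R})
    (h_ : nat -> T -> R) (h g : T -> R) :
  (forall k, measurable_fun setT (h_ k)) -> measurable_fun setT h ->
  mu.-integrable setT (EFin \o g) ->
  {ae mu, forall t, h_ k t @[k --> \oo] --> h t} ->
  (forall k t, `|h_ k t| <= g t) ->
  (\int[mu]_t h_ k t)%R @[k --> \oo] --> (\int[mu]_t h t)%R.
Proof.
move=> mh_ mh ig hh hg.
have mEh k : measurable_fun setT (EFin \o h_ k) by apply/measurable_EFinP.
have mE : measurable_fun setT (EFin \o h) by apply/measurable_EFinP.
have hhE : {ae mu, forall t, setT t ->
    (fun k => (EFin \o h_ k) t) @ \oo --> (EFin \o h) t}.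
  by apply: filterS hh => t ht _; apply: cvg_EFin => //; exact: nearW.
have hgE : {ae mu, forall t k, setT t -> (`|(EFin \o h_ k) t| <= (EFin \o g) t)%E}.
  by apply: aeW => t k _; rewrite /= lee_fin.
have [ih _ lim] := dominated_convergence measurableT mEh mE hhE ig hgE.
by apply: fine_cvg; rewrite /Rintegral fineK //; exact: integrable_fin_num.
Qed.

End dominated.

Section expectation.
Context {d : measure_display} {T : measurableType d} {R : realType}.
Variable P : probability T R.
Implicit Types f g : T -> R.
Local Notation E f := (\int[P]_t f t)%R.

Lemma bounded_measurable_integrable f :
  bounded_measurable f -> P.-integrable setT (EFin \o f).
Proof.
move=> [mf [K fK]]; apply: measurable_bounded_integrable => //.
  by apply: le_lt_trans (ltry 1); rewrite -(probability_setT P) le_measure ?inE.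
exists `|K|; split=> [|M KM t _]; first exact: num_real.
apply: (le_trans (fK t)).
by rewrite (le_trans (ler_norm _)) // ltW.
Qed.

Lemma expect_cst (c : R) : E (fun=> c) = c.
Proof.
by rewrite Rintegral_cst // [X in fine X](@probability_setT _ _ _ P) mulr1.
Qed.

Lemma expect_lin (c : R) f g : bounded_measurable f -> bounded_measurable g ->
  E (fun t => c * f t + g t) = c * E f + E g.
Proof.
move=> bf bg; rewrite RintegralD //; last exact: bounded_measurable_integrable.
  by rewrite RintegralZl //; exact: bounded_measurable_integrable.
apply: bounded_measurable_integrable; apply: bounded_measurableM => //.
exact: bounded_measurable_cst.
Qed.

Lemma expectD f g : bounded_measurable f -> bounded_measurable g ->
  E (fun t => f t + g t) = E f + E g.
Proof. by move=> bf bg; rewrite RintegralD //; exact: bounded_measurable_integrable. Qed.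

Lemma expectB f g : bounded_measurable f -> bounded_measurable g ->
  E (fun t => f t - g t) = E f - E g.
Proof. by move=> bf bg; rewrite RintegralB //; exact: bounded_measurable_integrable. Qed.

Lemma expectZ c f : bounded_measurable f -> E (fun t => c * f t) = c * E f.
Proof. by move=> bf; rewrite RintegralZl //; exact: bounded_measurable_integrable. Qed.

Lemma expect_sum (I : Type) (s : seq I) (F : I -> T -> R) :
  (forall i, bounded_measurable (F i)) ->
  E (fun t => \sum_(i <- s) F i t) = \sum_(i <- s) E (F i).
Proof.
move=> bF; elim: s => [|i s IH].
  by rewrite big_nil; under eq_Rintegral do rewrite big_nil; rewrite expect_cst.
rewrite big_cons -IH; under eq_Rintegral do rewrite big_cons.
by rewrite expectD //; exact: bounded_measurable_sum.
Qed.

Lemma expect_le f g : bounded_measurable f -> bounded_measurable g ->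
  (forall t, f t <= g t) -> E f <= E g.
Proof. by move=> bf bg fg; apply: le_Rintegral => //; exact: bounded_measurable_integrable. Qed.

Lemma expect_norm_le f K : bounded_measurable f -> (forall t, `|f t| <= K) ->
  `|E f| <= K.
Proof.
move=> bf fK; have fKK t : - K <= f t <= K by rewrite -ler_norml.
rewrite ler_norml; apply/andP; split.
  rewrite -(expect_cst (- K)); apply: expect_le => //; first exact: bounded_measurable_cst.
  by move=> t; case/andP: (fKK t).
rewrite -[leRHS](expect_cst K); apply: expect_le => //; first exact: bounded_measurable_cst.
by move=> t; case/andP: (fKK t).
Qed.

Lemma expect_indic (A : set T) : measurable A -> E \1_A = fine (P A).
Proof. by move=> mA; rewrite /Rintegral integral_indic // setIT. Qed.

Lemma expect_dominated_cvg (h_ : nat -> T -> R) (h : T -> R) K :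
  (forall k, measurable_fun setT (h_ k)) -> measurable_fun setT h ->
  {ae P, forall t, h_ k t @[k --> \oo] --> h t} ->
  (forall k t, `|h_ k t| <= K) -> E (h_ k) @[k --> \oo] --> E h.
Proof.
move=> mh_ mh hh hK; apply: (@Rintegral_dominated_cvg _ _ _ P h_ h (fun=> K)) => //.
by apply: bounded_measurable_integrable; exact: bounded_measurable_cst.
Qed.
End expectation.

(** * Integration against densities *)

Section densities.
Context {R : realType}.
Implicit Types (p g phi psi : R -> R).
Local Notation leb := (@lebesgue_measure R).

Definition density p := [/\ measurable_fun setT p, forall v, 0 <= p v &
  (\int[leb]_v (p v)%:E = 1)%E].

Definition density_integral p phi : R := (\int[leb]_v (phi v * p v))%R.

Lemma integrable_scale (c : R) g : leb.-integrable setT (EFin \o g) ->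
  leb.-integrable setT (EFin \o (fun v => c * g v)).
Proof.
move=> ig; have := integrableZl measurableT c ig.
by apply: eq_integrable.
Qed.

Lemma density_integrable p : density p -> leb.-integrable setT (EFin \o p).
Proof.
move=> [mp p0 p1]; apply/integrableP; split; first exact/measurable_EFinP.
under eq_integral do rewrite /= ger0_norm //.
by rewrite p1 ltry.
Qed.

Lemma dominated_by_density p g K : density p -> measurable_fun setT g ->
  (forall v, `|g v| <= K * p v) -> leb.-integrable setT (EFin \o g).
Proof.
move=> dp mg gK; have ip := density_integrable dp.
have iKp : leb.-integrable setT (EFin \o (fun v => K * p v)).
  exact: integrable_scale.
apply: (le_integrable measurableT _ _ iKp); first exact/measurable_EFinP.
move=> v _ /=; rewrite lee_fin (le_trans (gK v)) //; exact: ler_norm.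
Qed.

Lemma Rintegral_density p : density p -> (\int[leb]_v p v)%R = 1.
Proof. by move=> [_ _ p1]; rewrite /Rintegral p1. Qed.

Lemma Rintegral_dominated_le p g K : density p -> measurable_fun setT g ->
  (forall v, `|g v| <= K * p v) -> `|(\int[leb]_v g v)%R| <= K.
Proof.
move=> dp mg gK; have ig := dominated_by_density dp mg gK.
have ip := density_integrable dp.
apply: (le_trans (le_normr_Rintegral measurableT ig)).
rewrite -[leRHS]mulr1 -(Rintegral_density dp) -RintegralZl //.
apply: le_Rintegral => //; first exact: (integrable_norm ig).
exact: integrable_scale.
Qed.

Lemma bounded_times_density p phi : density p -> bounded_measurable phi ->
  leb.-integrable setT (EFin \o (fun v => phi v * p v)).
Proof.
move=> dp [mphi [K phiK]]; have [mp p0 _] := dp.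
apply: (dominated_by_density (K := K) dp); first exact: measurable_funM.
by move=> v; rewrite normrM (ger0_norm (p0 v)) ler_wpM2r.
Qed.

Lemma density_integral_lin p c phi psi : density p ->
  bounded_measurable phi -> bounded_measurable psi ->
  density_integral p (fun v => c * phi v + psi v)
  = c * density_integral p phi + density_integral p psi.
Proof.
move=> dp bphi bpsi; rewrite /density_integral.
under eq_Rintegral do rewrite mulrDl -mulrA.
have i1 := bounded_times_density dp bphi; have i2 := bounded_times_density dp bpsi.
rewrite RintegralD //; last exact: integrable_scale.
by rewrite RintegralZl.
Qed.

Lemma density_integral_norm_le p phi K : density p -> measurable_fun setT phi ->
  (forall v, `|phi v| <= K) -> `|density_integral p phi| <= K.
Proof.
move=> dp mphi phiK; have [mp p0 _] := dp; apply: (Rintegral_dominated_le dp).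
  exact: measurable_funM.
by move=> v; rewrite normrM (ger0_norm (p0 v)) ler_wpM2r.
Qed.

Lemma density_integral_indic p (B : set R) : measurable B ->
  density_integral p \1_B = (\int[leb]_(v in B) p v)%R.
Proof.
move=> mB; rewrite [RHS]Rintegral_mkcond; apply: eq_Rintegral => v _.
by rewrite /patch indicE; case: (_ \in _); rewrite ?mul1r ?mul0r.
Qed.

(** Scheffe: pointwise convergence of densities is convergence in mean, since
[|p_k - p| = p_k - p + 2 (p - p_k)^+] and the last term is dominated by [2 p]. *)
Lemma scheffe (p_ : nat -> R -> R) p : (forall k, density (p_ k)) -> density p ->
  (forall v, p_ k v @[k --> \oo] --> p v) ->
  (\int[leb]_v `|p_ k v - p v|)%R @[k --> \oo] --> 0.
Proof.
move=> dp_ dp pp; have [mp p0 _] := dp.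
have mp_ k : measurable_fun setT (p_ k) by case: (dp_ k).
pose q k v := Num.max (p v - p_ k v) 0.
have mq k : measurable_fun setT (q k).
  by apply: measurable_maxr => //; exact: measurable_funB.
have q_le k v : `|q k v| <= p v.
  have [_ pk0 _] := dp_ k; rewrite ger0_norm; last by rewrite le_max lexx orbT.
  by rewrite ge_max p0 andbT gerBl.
have iq k : leb.-integrable setT (EFin \o q k).
  by apply: (dominated_by_density (K := 1) dp) => // v; rewrite mul1r.
have -> : (fun k => (\int[leb]_v `|p_ k v - p v|)%R) = (fun k => 2 * (\int[leb]_v q k v)%R).
  apply/funext => k; have ipk := density_integrable (dp_ k); have ip := density_integrable dp.
  have -> : (\int[leb]_v `|p_ k v - p v|)%R
      = (\int[leb]_v ((p_ k v - p v) + 2 * q k v))%R.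
    apply: eq_Rintegral => v _; rewrite /q; case: (leP (p v - p_ k v) 0) => h.
      by rewrite mulr0 addr0 ger0_norm // -opprB oppr_ge0.
    by rewrite ltr0_norm; [ring|rewrite -opprB oppr_lt0].
  rewrite RintegralD //.
  - rewrite RintegralB // (Rintegral_density (dp_ k)) (Rintegral_density dp).
    by rewrite subrr add0r RintegralZl.
  - exact: (integrableB measurableT ipk ip).
  - exact: integrable_scale.
have int0 : (\int[leb]_v (0 : R))%R = 0 by rewrite /Rintegral integral0_eq.
rewrite -[X in _ --> X](mulr0 2) -int0; apply: cvgMl_tmp.
apply: (@Rintegral_dominated_cvg _ _ _ leb q (fun=> 0) p) => //.
  exact: density_integrable.
apply: aeW => v; apply/cvgr0Pnorm_le => e e0.
have /cvgrPdist_le/(_ _ e0) := pp v; apply: filterS => k.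
by rewrite ler_norml /q ger0_norm ?le_max ?lexx ?orbT // ge_max (ltW e0) andbT => /andP[].
Qed.

(** Integrand and density may vary together: the integrand is treated by domination
under the limit density, the change of density by Scheffe. The integrand converges
only where the limit density is positive, as log-likelihood ratios may jump at the
boundary of the support. *)
Lemma cvg_density_integral (p_ : nat -> R -> R) p (phi_ : nat -> R -> R) phi K :
  (forall k, density (p_ k)) -> density p -> (forall v, p_ k v @[k --> \oo] --> p v) ->
  (forall k, measurable_fun setT (phi_ k)) -> measurable_fun setT phi ->
  (forall k v, `|phi_ k v| <= K) ->
  (forall v, 0 < p v -> phi_ k v @[k --> \oo] --> phi v) ->
  density_integral (p_ k) (phi_ k) @[k --> \oo] --> density_integral p phi.
Proof.
move=> dp_ dp pp mphi_ mphi phiK phiphi; have [mp p0 _] := dp.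
have mp_ k : measurable_fun setT (p_ k) by case: (dp_ k).
have b k : bounded_measurable (phi_ k) by split; [|exists K].
have idiff k : leb.-integrable setT (EFin \o (fun v => p_ k v - p v)).
  exact: (integrableB measurableT (density_integrable (dp_ k)) (density_integrable dp)).
have split_int k : density_integral (p_ k) (phi_ k) =
    (\int[leb]_v (phi_ k v * p v))%R + (\int[leb]_v (phi_ k v * (p_ k v - p v)))%R.
  rewrite /density_integral -RintegralD //.
  - by apply: eq_Rintegral => v _; ring.
  - exact: bounded_times_density.
  - have := integrableB measurableT (bounded_times_density (dp_ k) (b k))
      (bounded_times_density dp (b k)).
    by apply: eq_integrable => // v _ /=; rewrite -EFinB mulrBr.
rewrite (funext split_int).
suff [lim1 lim2] :
    (\int[leb]_v (phi_ k v * p v))%R @[k --> \oo] --> density_integral p phi /\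
    (\int[leb]_v (phi_ k v * (p_ k v - p v)))%R @[k --> \oo] --> 0.
  by have := cvgD lim1 lim2; rewrite addr0; exact.
split.
  apply: (@Rintegral_dominated_cvg _ _ _ leb (fun k v => phi_ k v * p v)
    (fun v => phi v * p v) (fun v => K * p v)).
  - by move=> k; apply: measurable_funM; [exact: mphi_|exact: mp].
  - by apply: measurable_funM; [exact: mphi|exact: mp].
  - exact: integrable_scale (density_integrable dp).
  - apply: aeW => v; have := p0 v; rewrite le_eqVlt => /predU1P[<-|pv].
      by under eq_fun do rewrite mulr0; rewrite mulr0; exact: cvg_cst.
    by apply: cvgMr_tmp; exact: phiphi.
  - by move=> k v; rewrite normrM (ger0_norm (p0 v)) ler_wpM2r.
have lim0 : K * (\int[leb]_v `|p_ k v - p v|)%R @[k --> \oo] --> K * 0.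
  by apply: cvgMl_tmp; exact: scheffe.
rewrite mulr0 in lim0.
apply/norm_cvg0P; apply: (squeeze_cvgr _ _ lim0); last exact: cvg_cst.
apply: nearW => k; rewrite normr_ge0 /=.
have iphi : leb.-integrable setT (EFin \o (fun v => phi_ k v * (p_ k v - p v))).
  have := integrableB measurableT (bounded_times_density (dp_ k) (b k))
    (bounded_times_density dp (b k)).
  by apply: eq_integrable => // v _ /=; rewrite -EFinB mulrBr.
apply: (le_trans (le_normr_Rintegral measurableT iphi)).
rewrite -RintegralZl //; last exact: (integrable_norm (idiff k)).
apply: le_Rintegral => //.
- exact: (integrable_norm iphi).
- exact: (integrable_scale K (integrable_norm (idiff k))).
- by move=> v _; rewrite normrM ler_wpM2r.
Qed.

End densities.

(** * Samples from a random density *)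

Lemma measurable_finite_choice {R : realType} d (T : measurableType d) (F : finType)
    (cell : T -> F) (h : F -> T -> R) :
  (forall c, measurable [set t | cell t = c]) -> (forall c, measurable_fun setT (h c)) ->
  measurable_fun setT (fun t => h (cell t) t).
Proof.
move=> mcell mh.
have -> : (fun t => h (cell t) t)
    = (fun t => \sum_(c <- index_enum F) \1_[set t | cell t = c] t * h c t).
  apply/funext => t; rewrite (bigD1 (cell t)) //= indicE mem_set // mul1r.
  rewrite big1 ?addr0 // => c /eqP ct; rewrite indicE memNset ?mul0r //=.
  by move=> tc; apply: ct.
elim: (index_enum F) => [|c s IH].
  by under eq_fun do rewrite big_nil; exact: measurable_cst.
under eq_fun do rewrite big_cons; apply: measurable_funD => //.
by apply: measurable_funM => //; exact: measurable_indic.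
Qed.

(** The state space carries no sigma-algebra: the function is measurable as the limit of
its values at finitely valued approximations of the state. *)
Lemma measurable_state_fun {R : realType} d (T : measurableType d) (St : Type)
    (st : T -> St) (C : nat -> finType) (cell : forall m, T -> C m)
    (rep : forall m, C m -> St) (h : St -> T -> R) :
  (forall m c, measurable [set t | cell m t = c]) ->
  (forall m c, measurable_fun setT (h (rep m c))) ->
  (forall t, h (rep m (cell m t)) t @[m --> \oo] --> h (st t) t) ->
  measurable_fun setT (fun t => h (st t) t).
Proof.
move=> mcell mh hh.
apply: (measurable_fun_cvg (h := fun m t => h (rep m (cell m t)) t)) => // m.
exact: (measurable_finite_choice (h := fun c => h (rep m c))).
Qed.

(** A sample [y] whose conditional density given the sigma-algebra generated by [G] is
[dens (st w)], for a state [st] that is a limit of finitely valued [G]-measurable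
states. The approximation of the state makes functions of state and sample measurable
that are only separately regular in the two arguments. *)
Section random_state.
Context {d : measure_display} {Omega : measurableType d} {R : realType}.
Variable P : probability Omega R.
Variables (St : Type) (good : set St) (st : Omega -> St) (C : nat -> finType).
Variables (cell : forall m, Omega -> C m) (rep : forall m, C m -> St).
Variable dens : St -> R -> R.
Variable G : set (set Omega).
Variable y : Omega -> R.
Local Notation E f := (\int[P]_w f w)%R.
Let stm m w := rep (cell m w).
Hypothesis good_st : forall w, good (st w).
Hypothesis good_rep : forall m (c : C m), good (rep c).
Hypothesis dens_density : forall s, good s -> density (dens s).
Hypothesis dens_cvg : forall w v, dens (stm m w) v @[m --> \oo] --> dens (st w) v.
Arguments dens_cvg : clear implicits.
Hypothesis G_measurable : <<s G>> `<=` measurable.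
Hypothesis cell_G : forall m (c : C m), <<s G>> [set w | cell m w = c].
Hypothesis y_measurable : measurable_fun setT y.
Hypothesis law : forall A B, <<s G>> A -> measurable B ->
  E (fun w => \1_A w * \1_B (y w))
  = E (fun w => \1_A w * density_integral (dens (st w)) \1_B).

Let mcell m (c : C m) : measurable [set w | cell m w = c].
Proof. by apply: G_measurable; exact: cell_G. Qed.

Let dens_st w : density (dens (st w)).
Proof. by apply: dens_density; exact: good_st. Qed.
Let dens_stm m w : density (dens (stm m w)).
Proof. by apply: dens_density; exact: good_rep. Qed.

Lemma state_integral_measurable (phi : St -> R -> R) K :
  (forall s, good s -> measurable_fun setT (phi s)) ->
  (forall s, good s -> forall v, `|phi s v| <= K) ->
  (forall w v, 0 < dens (st w) v -> phi (stm m w) v @[m --> \oo] --> phi (st w) v) ->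
  measurable_fun setT ((fun w => density_integral (dens (st w)) (phi (st w)))
     : g_sigma_algebraType G -> R).
Proof.
move=> mphi phiK phiphi.
apply: (measurable_state_fun (T := g_sigma_algebraType G) (cell := cell) (rep := rep)
  (h := fun s _ => density_integral (dens s) (phi s))).
- exact: cell_G.
- by move=> m c; exact: measurable_cst.
move=> w; apply: (cvg_density_integral (p_ := fun m => dens (stm m w))
  (phi_ := fun m => phi (stm m w)) (K := K)).
- by move=> m; exact: dens_stm.
- exact: dens_st.
- exact: dens_cvg.
- by move=> m; apply: mphi; exact: good_rep.
- by apply: mphi; exact: good_st.
- by move=> m; apply: phiK; exact: good_rep.
- exact: phiphi.
Qed.

Lemma sub_measurable (psi : Omega -> R) :
  measurable_fun setT (psi : g_sigma_algebraType G -> R) -> measurable_fun setT psi.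
Proof.
move=> mpsi _ B mB; rewrite setTI; apply: G_measurable.
by have := mpsi measurableT B mB; rewrite setTI.
Qed.

Let bounded_state_integral (phi : St -> R -> R) K :
  (forall s, good s -> measurable_fun setT (phi s)) ->
  (forall s, good s -> forall v, `|phi s v| <= K) ->
  (forall w v, 0 < dens (st w) v -> phi (stm m w) v @[m --> \oo] --> phi (st w) v) ->
  bounded_measurable (fun w => density_integral (dens (st w)) (phi (st w))).
Proof.
move=> mphi phiK phiphi; split.
  by apply: sub_measurable; exact: state_integral_measurable mphi phiK phiphi.
by exists K => w; apply: density_integral_norm_le => //; [apply: mphi|apply: phiK]; exact: good_st.
Qed.

Let bounded_cst_integral (phi : R -> R) : bounded_measurable phi ->
  bounded_measurable (fun w => density_integral (dens (st w)) phi).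
Proof.
move=> [mphi [K phiK]]; apply: (@bounded_state_integral (fun=> phi) K) => //.
by move=> w v _; exact: cvg_cst.
Qed.

Let bounded_comp (phi : R -> R) : bounded_measurable phi ->
  bounded_measurable (fun w => phi (y w)).
Proof.
by move=> [mphi [K phiK]]; split; [exact: measurableT_comp|exists K].
Qed.

Lemma indic_mul_le (A : set Omega) (a K : R) w : `|a| <= K -> `|\1_A w * a| <= K.
Proof.
move=> aK; rewrite normrM indicE; case: (_ \in _); first by rewrite normr1 mul1r.
by rewrite normr0 mul0r (le_trans _ aK).
Qed.

Lemma law_bounded A (phi : R -> R) : <<s G>> A -> bounded_measurable phi ->
  E (fun w => \1_A w * phi (y w))
  = E (fun w => \1_A w * density_integral (dens (st w)) phi).
Proof.
move=> GA; have bA := bounded_measurable_indic (R := R) (G_measurable GA).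
move: phi; apply: bounded_measurable_ind.
- by move=> B mB; exact: law.
- move=> c f g bf bg Ef Eg.
  under eq_Rintegral do rewrite mulrDr mulrCA.
  under [RHS]eq_Rintegral do rewrite density_integral_lin // mulrDr mulrCA.
  by rewrite !expect_lin ?Ef ?Eg //; apply: bounded_measurableM => //;
    first [exact: bounded_comp|exact: bounded_cst_integral].
move=> f bf approx; apply/eqP; rewrite -subr_eq0 -normr_le0.
apply/ler_addgt0Pr => e e0; rewrite add0r.
have e20 : 0 < e / 2 by rewrite divr_gt0.
have [g [bg Eg fg]] := approx _ e20.
have bfy := bounded_measurableM bA (bounded_comp bf).
have bgy := bounded_measurableM bA (bounded_comp bg).
have bfi := bounded_measurableM bA (bounded_cst_integral bf).
have bgi := bounded_measurableM bA (bounded_cst_integral bg).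
have d1 : `|E (fun w => \1_A w * f (y w)) - E (fun w => \1_A w * g (y w))| <= e / 2.
  rewrite -expectB //; apply: expect_norm_le; first exact: bounded_measurableB.
  by move=> w; rewrite -mulrBr; apply: indic_mul_le.
have d2 : `|E (fun w => \1_A w * density_integral (dens (st w)) f)
    - E (fun w => \1_A w * density_integral (dens (st w)) g)| <= e / 2.
  rewrite -expectB //; apply: expect_norm_le; first exact: bounded_measurableB.
  move=> w; rewrite -mulrBr; apply: indic_mul_le.
  have -> : density_integral (dens (st w)) f - density_integral (dens (st w)) g
      = density_integral (dens (st w)) (fun v => -1 * g v + f v).
    by rewrite density_integral_lin // mulN1r addrC.
  apply: density_integral_norm_le => //.
    apply: (bounded_measurableD _ bf).1; apply: bounded_measurableM => //.
    exact: bounded_measurable_cst.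
  by move=> v; rewrite mulN1r addrC.
move: d1 d2; rewrite Eg !ler_norml; lra.
Qed.

(** On each cell the approximate state is constant and [law_bounded] applies; the
densities themselves are not approximated in this step. *)
Lemma law_state A (phi : St -> R -> R) K : <<s G>> A ->
  (forall s, good s -> measurable_fun setT (phi s)) ->
  (forall s, good s -> forall v, `|phi s v| <= K) ->
  (forall w v, 0 < dens (st w) v -> phi (stm m w) v @[m --> \oo] --> phi (st w) v) ->
  {ae P, forall w, phi (stm m w) (y w) @[m --> \oo] --> phi (st w) (y w)} ->
  measurable_fun setT (fun w => phi (st w) (y w)) ->
  E (fun w => \1_A w * phi (st w) (y w))
  = E (fun w => \1_A w * density_integral (dens (st w)) (phi (st w))).
Proof.
move=> GA mphi phiK phiphi aephi mphist.
have mA := G_measurable GA; have bA := bounded_measurable_indic (R := R) mA.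
have bphi s : good s -> bounded_measurable (phi s).
  by move=> gs; split; [exact: mphi|exists K; exact: phiK].
have bcell m c := bounded_measurable_indic (R := R) (mcell (m := m) c).
pose Am m c := A `&` [set w | cell m w = c].
have GAm m c : <<s G>> (Am m c).
  have mG : (measurable : set (set (g_sigma_algebraType G))) (Am m c).
    by apply: measurableI; [exact: GA|exact: cell_G].
  exact: mG.
have bAm m c := bounded_measurable_indic (R := R) (G_measurable (GAm m c)).
have decomp m (F : C m -> Omega -> R) w : \1_A w * F (cell m w) w
    = \sum_(c <- index_enum (C m)) \1_(Am m c) w * F c w.
  rewrite (bigD1 (cell m w)) //= big1 ?addr0 => [|c /eqP cw].
    by congr (_ * _); rewrite /Am indicI /= (@indicE _ _ [set _ | _]) mem_set // mulr1.
  rewrite /Am indicI /= (@indicE _ _ [set _ | _]) memNset ?mulr0 ?mul0r //=.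
  by move=> wc; apply: cw.
have step m : E (fun w => \1_A w * phi (stm m w) (y w))
    = E (fun w => \1_A w * density_integral (dens (st w)) (phi (stm m w))).
  under eq_Rintegral do rewrite (decomp m (fun c w => phi (rep c) (y w))).
  under [RHS]eq_Rintegral do
    rewrite (decomp m (fun c w => density_integral (dens (st w)) (phi (rep c)))).
  rewrite !expect_sum.
  - by apply: eq_bigr => c _; apply: law_bounded => //; exact: bphi.
  - move=> c; apply: bounded_measurableM => //; apply: bounded_cst_integral; exact: bphi.
  - move=> c; apply: bounded_measurableM => //; apply: bounded_comp; exact: bphi.
have lim1 : E (fun w => \1_A w * phi (stm m w) (y w)) @[m --> \oo]
    --> E (fun w => \1_A w * phi (st w) (y w)).
  apply: (expect_dominated_cvg (K := K)).
  - move=> m; apply: measurable_funM; first exact: measurable_indic.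
    apply: (measurable_finite_choice (h := fun c w => phi (rep c) (y w))) => // c.
    by apply: measurableT_comp => //; exact: mphi.
  - by apply: measurable_funM => //; exact: measurable_indic.
  - by apply: filterS aephi => w hw; apply: cvgMl_tmp.
  - by move=> m w; apply: indic_mul_le; apply: phiK; exact: good_rep.
have lim2 : E (fun w => \1_A w * density_integral (dens (st w)) (phi (stm m w)))
    @[m --> \oo] --> E (fun w => \1_A w * density_integral (dens (st w)) (phi (st w))).
  apply: (expect_dominated_cvg (K := K)).
  - move=> m; apply: measurable_funM; first exact: measurable_indic.
    apply: (measurable_finite_choice
      (h := fun c w => density_integral (dens (st w)) (phi (rep c)))) => // c.
    by apply: (bounded_cst_integral _).1; exact: bphi.
  - apply: measurable_funM; first exact: measurable_indic.
    exact: (bounded_state_integral mphi phiK phiphi).1.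
  - apply: aeW => w; apply: cvgMl_tmp; apply: (cvg_density_integral
      (p_ := fun=> dens (st w)) (phi_ := fun m => phi (stm m w)) (K := K)) => //.
    + by move=> v; exact: cvg_cst.
    + by move=> m; apply: mphi; exact: good_rep.
    + by apply: mphi; exact: good_st.
    + by move=> m; apply: phiK; exact: good_rep.
    + exact: phiphi.
  - move=> m w; apply: indic_mul_le; apply: density_integral_norm_le => //.
      by apply: mphi; exact: good_rep.
    by apply: phiK; exact: good_rep.
rewrite (funext step) in lim1.
exact: cvg_unique lim1 lim2.
Qed.

(** With a fixed positive density [q], the function [max 0 (1 - p / (e q))] dominates
the indicator of [p = 0], is continuous in [p], and integrates to at most [e] against
[p]; continuity makes [law_state] applicable where the indicator is not. *)
Lemma density_at_sample_gt0 : {ae P, forall w, 0 < dens (st w) (y w)}.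
Proof.
pose q : R -> R := normal_pdf 0 1.
have q_gt0 v : 0 < q v.
  rewrite /q normal_pdfE ?oner_neq0 //.
  by rewrite mulr_gt0 ?expR_gt0 // normal_peak_gt0 ?oner_neq0.
have mq : measurable_fun setT q by exact: measurable_normal_pdf.
have q1 : (\int[lebesgue_measure]_v (q v)%:E = 1)%E by exact: integral_normal_pdf.
have dq : density q by split=> // v; exact: ltW.
have mdens_y : measurable_fun setT (fun w => dens (st w) (y w)).
  apply: (measurable_state_fun (h := fun s w => dens s (y w)) mcell) => [m c|w].
    have [md _ _] := dens_density (good_rep c).
    exact: (measurableT_comp md y_measurable).
  exact: dens_cvg.
pose Z := [set w | dens (st w) (y w) <= 0].
have mZ : measurable Z.
  rewrite -[Z]setTI; have -> : Z = (fun w => dens (st w) (y w)) @^-1` `]-oo, 0%R].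
    by apply/seteqP; split=> w; rewrite /Z /= in_itv.
  by apply: mdens_y => //; exact: measurable_itv.
pose phi e s v := Num.max (1 - dens s v / (e * q v)) 0.
have small e : 0 < e -> fine (P Z) <= e.
  move=> e0; have eq0 v : 0 < e * q v by rewrite mulr_gt0.
  have mphi s : good s -> measurable_fun setT (phi e s).
    move=> gs; have [md _ _] := dens_density gs.
    have -> : phi e s = (fun v => Num.max (1 - dens s v * (e * q v) `^ (-1)) 0).
      by apply/funext => v; rewrite powR_inv1 // ltW.
    apply: measurable_maxr => //; apply: measurable_funB => //.
    apply: measurable_funM => //.
    apply: (measurableT_comp (measurable_powR (-1))).
    by apply: measurable_funM.
  have phi01 s : good s -> forall v, `|phi e s v| <= 1.
    move=> gs v; have [_ d0 _] := dens_density gs.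
    rewrite ger0_norm ?le_max ?lexx ?orbT // ge_max ler01 andbT gerBl.
    by rewrite divr_ge0 // ltW.
  have phi_cvg w v : phi e (stm m w) v @[m --> \oo] --> phi e (st w) v.
    have Fc : continuous ((fun r : R => 1 - r / (e * q v) : R^o) \max (fun=> 0)).
      move=> r; apply: continuous_max; last exact: cvg_cst.
      by apply: cvgB; [exact: cvg_cst|apply: cvgMr_tmp; exact: cvg_id].
    have := continuous_cvg _ (Fc (dens (st w) v)) (dens_cvg w v).
    exact.
  have mphist : measurable_fun setT (fun w => phi e (st w) (y w)).
    apply: (measurable_state_fun (h := fun s w => phi e s (y w)) mcell) => [m c|w].
      exact: (measurableT_comp (mphi _ (good_rep c)) y_measurable).
    exact: phi_cvg.
  have GT : <<s G>> setT by exact: (@measurableT _ (g_sigma_algebraType G)).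
  have := law_state GT mphi phi01 (fun w v _ => phi_cvg w v) (aeW _ (fun w => phi_cvg w _)) mphist.
  under eq_Rintegral do rewrite indicT mul1r.
  under [RHS]eq_Rintegral do rewrite indicT mul1r.
  move=> lawphi; rewrite -(expect_indic P mZ).
  have bphist : bounded_measurable (fun w => phi e (st w) (y w)).
    by split=> //; exists 1 => w; apply: phi01.
  apply: (@le_trans _ _ (E (fun w => phi e (st w) (y w)))).
    apply: expect_le => //; first exact: bounded_measurable_indic.
    move=> w; rewrite indicE; have [wZ|wZ] := boolP (w \in Z).
      rewrite le_max; apply/orP; left; rewrite lerBrDl gerDr.
      by move: wZ; rewrite inE /Z /= => wZ; rewrite mulr_le0_ge0 // invr_ge0 ltW.
    by rewrite le_max lexx orbT.
  rewrite lawphi; apply: (le_trans (ler_norm _)); apply: expect_norm_le.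
    exact: (bounded_state_integral mphi phi01 (fun w v _ => phi_cvg w v)).
  move=> w; apply: (Rintegral_dominated_le dq).
    by apply: measurable_funM; [exact: mphi|case: (dens_st w)].
  move=> v; have [_ d0 _] := dens_st w.
  rewrite normrM (ger0_norm (d0 v)) ger0_norm ?le_max ?lexx ?orbT //.
  rewrite /phi; case: (leP (1 - dens (st w) v / (e * q v)) 0) => h.
    by rewrite mul0r ltW.
  have h' : dens (st w) v <= e * q v.
    by move: h; rewrite subr_gt0 ltr_pdivrMr // mul1r => /ltW.
  apply: le_trans h'; rewrite ler_piMl // gerBl divr_ge0 // ltW //.
have PZ : P Z = 0%E.
  apply/eqP; rewrite -(fineK (fin_num_measure P Z mZ)) eqe.
  rewrite eq_le fine_ge0 // andbT; apply/ler_addgt0Pr => e e0; rewrite add0r; exact: small.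
exists Z; split=> // w /= /negP; by rewrite -leNgt.
Qed.

End random_state.

(** * Averaged noise *)

Section conditionally_centred.
Context {d : measure_display} {Omega : measurableType d} {R : realType}.
Variable P : probability Omega R.
Local Notation E f := (\int[P]_w f w)%R.

Lemma centred_orthogonal (G : set (set Omega)) (nz psi : Omega -> R) :
  <<s G>> `<=` measurable -> bounded_measurable nz ->
  (forall A, <<s G>> A -> E (fun w => \1_A w * nz w) = 0) ->
  bounded_measurable (psi : g_sigma_algebraType G -> R) ->
  E (fun w => psi w * nz w) = 0.
Proof.
move=> sG bn nz0.
have sub (f : Omega -> R) : bounded_measurable (f : g_sigma_algebraType G -> R) ->
    bounded_measurable f.
  by move=> [mf bf]; split => //; exact: (sub_measurable sG).
move: psi; apply: (@bounded_measurable_ind _ (g_sigma_algebraType G) R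
  (fun psi => E (fun w => psi w * nz w) = 0)).
- by move=> B mB; exact: nz0.
- move=> c f g /sub bf /sub bg Ef Eg.
  under eq_Rintegral do rewrite mulrDl -mulrA.
  by rewrite expect_lin ?Ef ?Eg ?mulr0 ?addr0 //; exact: bounded_measurableM.
move=> f /sub bf approx; have [mn [K nK]] := bn.
apply/eqP; rewrite -normr_le0; apply/ler_addgt0Pr => e e0; rewrite add0r.
have K0 : 0 < `|K| + 1 by rewrite ltr_pwDr.
have [g [/sub bg Eg fg]] := approx (e / (`|K| + 1)) (divr_gt0 e0 K0).
have -> : E (fun w => f w * nz w) = E (fun w => f w * nz w - g w * nz w).
  by rewrite expectB ?Eg ?subr0 //; exact: bounded_measurableM.
apply: expect_norm_le; first by apply: bounded_measurableB; exact: bounded_measurableM.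
move=> w; rewrite -mulrBl normrM; have -> : e = e / (`|K| + 1) * (`|K| + 1).
  by rewrite divfK // gt_eqF.
rewrite ler_pM // (le_trans (nK w)) // (le_trans (ler_norm K)) // lerDl //.
Qed.

(** By monotone convergence the series of squares is integrable, hence almost surely
finite. *)
Lemma summable_moments_cvg0 (X_ : nat -> Omega -> R) (B : R) :
  (forall k, bounded_measurable (X_ k)) ->
  (forall k, \sum_(0 <= j < k) E (fun w => X_ j w ^+ 2) <= B) ->
  {ae P, forall w, X_ k w @[k --> \oo] --> 0}.
Proof.
move=> bX XB.
have bX2 k : bounded_measurable (fun w => X_ k w ^+ 2).
  by under eq_fun do rewrite expr2; exact: bounded_measurableM.
pose s w := (\sum_(0 <= k <oo) (X_ k w ^+ 2)%:E)%E.
have mX2 k : measurable_fun setT (fun w => (X_ k w ^+ 2)%:E).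
  by apply/measurable_EFinP; exact: (bX2 k).1.
have X2_ge0 k w : setT w -> (0 <= (X_ k w ^+ 2)%:E)%E by rewrite lee_fin sqr_ge0.
have s_ge0 w : (0 <= s w)%E.
  by apply: nneseries_ge0 => k _ _; rewrite lee_fin sqr_ge0.
have int_s : (\int[P]_w s w <= B%:E)%E.
  rewrite /s integral_nneseries //; apply: lime_le.
    by apply: is_cvg_nneseries => k _ _; apply: integral_ge0 => w _; exact: X2_ge0.
  apply: nearW => k; apply: le_trans (_ : (\sum_(0 <= j < k) E (fun w => X_ j w ^+ 2))%:E <= _)%E;
    last by rewrite lee_fin.
  rewrite -sumEFin; apply: lee_sum => j _.
  rewrite /Rintegral fineK //; apply: integrable_fin_num => //.
  exact: bounded_measurable_integrable.
have ints : P.-integrable setT s.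
  apply/integrableP; split.
    by apply: ge0_emeasurable_sum => // k w _ _; exact: X2_ge0.
  under eq_integral do rewrite gee0_abs //.
  exact: le_lt_trans int_s (ltry _).
have := integrable_ae measurableT ints; apply: filterS => w /(_ I) sw.
have cv : cvgn (series (fun k => X_ k w ^+ 2)).
  apply: nondecreasing_is_cvgn.
    by apply/nondecreasing_seqP => k; rewrite /series /= big_nat_recr //= lerDl sqr_ge0.
  exists (fine (s w)) => _ [k _ <-]; rewrite -lee_fin fineK // /series /= -sumEFin.
  by apply: nneseries_lim_ge => j _ _; rewrite lee_fin sqr_ge0.
have /cvgr0Pnorm_lt sq := cvg_series_cvg_0 cv.
apply/cvgr0Pnorm_lt => e e0; have := sq _ (exprn_gt0 2 e0).
apply: filterS => k; rewrite normrX ltr_pXn2r // ?nnegrE // ltW //.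
Qed.

End conditionally_centred.

Lemma averaged_sqr_le {R : realType} {N : nat} (W : 'M[R]_N) (a : 'I_N -> R) i :
  row_stochastic W -> averaged W a i ^+ 2 <= averaged W (fun j => a j ^+ 2) i.
Proof.
move=> sW; set m := averaged W a i; rewrite -subr_ge0.
have -> : averaged W (fun j => a j ^+ 2) i - m ^+ 2 = \sum_j W i j * (a j - m) ^+ 2.
  transitivity (averaged W (fun j => a j ^+ 2) i - 2 * m * m + m ^+ 2); first by ring.
  rewrite {2}/m -averagedZ -[X in _ + X](averaged_cst _ i sW) -averagedB -averagedD.
  by apply: eq_bigr => j _; congr (_ * _); ring.
by rewrite sumr_ge0 // => j _; rewrite mulr_ge0 ?sqr_ge0 //; case: sW.
Qed.

Lemma inverse_square_sum_le {R : realType} (k : nat) :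
  \sum_(0 <= j < k) (j.+2%:R ^+ 2)^-1 <= 2 - (k.+1%:R)^-1 :> R.
Proof.
elim: k => [|k IH]; first by rewrite big_nil invr1; lra.
rewrite big_nat_recr //= (le_trans (lerD IH (lexx _))) //.
have k1 : 0 < k.+1%:R :> R by [].
rewrite -[k.+2%:R]natr1; move: (k.+1%:R) k1 => x x0.
have x1 : 0 < x + 1 by rewrite addr_gt0.
rewrite -subr_ge0.
have -> : 2 - (x + 1)^-1 - (2 - x^-1 + ((x + 1) ^+ 2)^-1) = (x * (x + 1) ^+ 2)^-1.
  by field; rewrite !gt_eqF.
by rewrite invr_ge0 mulr_ge0 ?sqr_ge0 // ltW.
Qed.

Section noise.
Context {d : measure_display} {Omega : measurableType d} {R : realType} {N : nat}.
Variables (P : probability Omega R) (W : 'M[R]_N) (alpha : nat -> R).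
Variables (G : nat -> set (set Omega)) (nz : nat -> 'I_N -> Omega -> R).
Variables (V : nat -> Omega -> 'I_N -> R) (K A2 : R).
Local Notation E f := (\int[P]_w f w)%R.
Local Notation S := (clock alpha).
Hypothesis sW : row_stochastic W.
Hypothesis alpha01 : forall t, 0 < alpha t < 1.
Hypothesis clock_oo : S @ \oo --> +oo.
Hypothesis alpha_sqr : forall T, \sum_(0 <= t < T) alpha t ^+ 2 <= A2.
Hypothesis G_mono : forall t, <<s G t>> `<=` <<s G t.+1>>.
Hypothesis G_measurable : forall t, <<s G t>> `<=` measurable.
Hypothesis nz_measurable : forall t j,
  measurable_fun setT (nz t j : g_sigma_algebraType (G t.+1) -> R).
Hypothesis nz_bound : forall t j w, `|nz t j w| <= K.
Hypothesis nz_centred : forall t j A, <<s G t>> A -> E (fun w => \1_A w * nz t j w) = 0.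
Hypothesis V0 : forall w i, V 0 w i = 0.
Hypothesis VS : forall t w i,
  V t.+1 w i = averaged W (fun j => V t w j + alpha t * nz t j w) i.

Let alpha_gt0 t : 0 < alpha t. Proof. by case/andP: (alpha01 t). Qed.

Lemma noise_bounded_measurable t i :
  bounded_measurable ((fun w => V t w i) : g_sigma_algebraType (G t) -> R).
Proof.
elim: t i => [|t IH] i.
  under eq_fun do rewrite V0; exact: bounded_measurable_cst.
under eq_fun do rewrite VS; apply: bounded_measurable_sum => j.
apply: bounded_measurableM; first exact: bounded_measurable_cst.
apply: bounded_measurableD.
  have [mV bV] := IH j; split=> // _ B mB; rewrite setTI; apply: (@G_mono t).
  by have := mV measurableT B mB; rewrite setTI.
apply: bounded_measurableM; first exact: bounded_measurable_cst.
by split=> //; exists K => w; exact: nz_bound.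
Qed.

Let bV t i : bounded_measurable (fun w => V t w i).
Proof.
have [mV vV] := noise_bounded_measurable t i; split=> //.
exact: (sub_measurable (@G_measurable t)).
Qed.

Let bnz t j : bounded_measurable (nz t j).
Proof.
split; first exact: (sub_measurable (@G_measurable t.+1)).
by exists K => w; exact: nz_bound.
Qed.

(** By Jensen's inequality along the stochastic rows pooling does not increase second
moments, and the new noise is orthogonal to the accumulated one. *)
Lemma noise_second_moment t i :
  E (fun w => V t w i ^+ 2) <= K ^+ 2 * \sum_(0 <= s < t) alpha s ^+ 2.
Proof.
elim: t i => [|t IH] i.
  under eq_Rintegral do rewrite V0 expr0n /=.
  by rewrite expect_cst big_nil mulr0.
have bsq (f : Omega -> R) : bounded_measurable f -> bounded_measurable (fun w => f w ^+ 2).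
  by move=> bf; under eq_fun do rewrite expr2; exact: bounded_measurableM.
have bstep j : bounded_measurable (fun w => V t w j + alpha t * nz t j w).
  apply: bounded_measurableD => //; apply: bounded_measurableM => //.
  exact: bounded_measurable_cst.
have bterm j : bounded_measurable (fun w => W i j * (V t w j + alpha t * nz t j w) ^+ 2).
  by apply: bounded_measurableM; [exact: bounded_measurable_cst|exact: bsq].
apply: (@le_trans _ _ (E (fun w => \sum_j W i j * (V t w j + alpha t * nz t j w) ^+ 2))).
  apply: expect_le; [exact: bsq|exact: bounded_measurable_sum|].
  by move=> w; rewrite VS; exact: averaged_sqr_le.
rewrite expect_sum // big_nat_recr //= mulrDr.
rewrite -[leRHS]mul1r; have [W0 W1] := sW; rewrite -(W1 i) mulr_suml.
apply: ler_sum => j _; rewrite expectZ; last exact: bsq.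
apply: ler_wpM2l => //.
have -> : E (fun w => (V t w j + alpha t * nz t j w) ^+ 2)
    = E (fun w => 2 * alpha t * (V t w j * nz t j w)
                  + (alpha t ^+ 2 * nz t j w ^+ 2 + V t w j ^+ 2)).
  by apply: eq_Rintegral => w _; ring.
have bb (c : R) f : bounded_measurable f -> bounded_measurable (fun w : Omega => c * f w).
  by move=> bf; apply: bounded_measurableM => //; exact: bounded_measurable_cst.
rewrite expect_lin; last 2 first.
- exact: bounded_measurableM.
- by apply: bounded_measurableD; [apply: bb|]; exact: bsq.
rewrite expect_lin; [|exact: bsq|exact: bsq].
have -> : E (fun w => V t w j * nz t j w) = 0.
  apply: (centred_orthogonal (G := G t) (@G_measurable t) (bnz t j)).
    by move=> A GA; exact: nz_centred.
  exact: noise_bounded_measurable.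
rewrite mulr0 add0r addrC lerD //.
rewrite mulrC ler_wpM2r ?sqr_ge0 //.
rewrite -[leRHS](expect_cst P) ; apply: expect_le; [exact: bsq|exact: bounded_measurable_cst|].
by move=> w; rewrite -ler_sqrt ?sqr_ge0 // !sqrtr_sqr (le_trans (nz_bound _ _ _)) // ler_norm.
Qed.

Lemma noise_window s t w i : (s <= t)%N ->
  `|V t w i| <= \sum_j `|V s w j| + K * (S t - S s).
Proof.
elim: t i => [|t IH] i.
  rewrite leqn0 => /eqP ->; rewrite subrr mulr0 addr0 (bigD1 i) //= lerDl.
  by rewrite sumr_ge0.
rewrite leq_eqVlt => /predU1P[->|st].
  by rewrite subrr mulr0 addr0 (bigD1 i) //= lerDl sumr_ge0.
rewrite VS; apply: averaged_bound => // j; apply: (le_trans (ler_normD _ _)).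
have -> : \sum_j `|V s w j| + K * (S t.+1 - S s)
    = \sum_j `|V s w j| + K * (S t - S s) + alpha t * K by rewrite clockS; ring.
by rewrite lerD ?IH // normrM gtr0_norm // ler_pM2l.
Qed.

(** The second moments are bounded, so the noise is negligible against the clock
along steps at which the clock passes the integers; in between it moves by a
bounded amount. *)
Lemma noise_negligible : {ae P, forall w, forall i, V t w i / S t @[t --> \oo] --> 0}.
Proof.
have [idx idxP] := clock_inverse clock_oo.
have A2_ge0 : 0 <= A2 by apply: le_trans (alpha_sqr 0); rewrite big_nil.
(* the offset 2 gives the bound of [inverse_square_sum_le] *)
have along j : {ae P, forall w, V (idx k.+2%:R) w j / k.+2%:R @[k --> \oo] --> 0}.
  have bX k : bounded_measurable (fun w => V (idx k.+2%:R) w j / k.+2%:R).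
    by apply: bounded_measurableM => //; exact: bounded_measurable_cst.
  apply: (summable_moments_cvg0 (B := K ^+ 2 * A2 * 2) bX) => k.
  apply: (@le_trans _ _ (\sum_(0 <= l < k) K ^+ 2 * A2 * (l.+2%:R ^+ 2)^-1)).
    apply: ler_sum => l _.
    under eq_Rintegral do rewrite exprMn exprVn mulrC.
    rewrite expectZ; last by under eq_fun do rewrite expr2; exact: bounded_measurableM.
    rewrite mulrC ler_wpM2r ?invr_ge0 ?sqr_ge0 //.
    apply: (le_trans (noise_second_moment _ _)).
    by rewrite ler_wpM2l ?sqr_ge0.
  rewrite -mulr_sumr ler_wpM2l //; first by rewrite mulr_ge0 ?sqr_ge0.
  by apply: (le_trans (inverse_square_sum_le k)); rewrite gerBl invr_ge0.
have : {ae P, forall w, forall j, V (idx k.+2%:R) w j / k.+2%:R @[k --> \oo] --> 0}.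
  exact: filter_forall.
apply: filterS => w Vw i.
pose Q k := \sum_j `|V (idx k.+2%:R) w j| / k.+2%:R.
have Q0 : Q k @[k --> \oo] --> 0.
  have : Q k @[k --> \oo] --> \sum_(j < N) (0 : R).
    apply: cvg_big => [|j _]; first exact: add_continuous.
    have -> : (fun k => `|V (idx k.+2%:R) w j| / k.+2%:R)
        = (fun k => `|V (idx k.+2%:R) w j / k.+2%:R|).
      by apply/funext => k; rewrite normrM normfV (ger0_norm (ler0n _ _)).
    have lim0 := cvg_norm (Vw j); rewrite normr0 in lim0; exact: lim0.
  by rewrite big1.
apply/cvgr0Pnorm_le => e e0.
have e20 : 0 < e / 2 by rewrite divr_gt0.
have /cvgr0Pnorm_le/(_ _ e20)[M _ MQ] := Q0.
have /cvgr0Pnorm_lt/(_ _ e20) small :=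
  bounded_over_diverging (fun _ : nat => lexx `|2 * `|K| |) clock_oo.
have /cvgryPge/(_ M.+2%:R) big := clock_oo.
apply: filterS2 small big => t small tM.
have St0 : 0 < S t by apply: lt_le_trans tM.
have /andP[k1 k2] := Num.Theory.truncn_itv (ltW St0).
(* the clock at [t] lies between [k + 2] and [k + 3], and the last step at which it is
at most [k + 2] lies less than one unit before [k + 2] *)
have [k kM kE] : exists2 k, (M <= k)%N & Num.truncn (S t) = k.+2.
  have : (M.+2 < (Num.truncn (S t)).+1)%N by rewrite -(ltr_nat R) (le_lt_trans tM).
  by case: (Num.truncn (S t)) => [|[|k]] //; rewrite !ltnS => kM; exists k.
rewrite kE in k1 k2; rewrite -[k.+3%:R]natr1 in k2.
have /idxP/andP[i1 i2] : 0 <= k.+2%:R :> R by [].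
have it : (idx k.+2%:R <= t)%N.
  by rewrite (clock_le alpha_gt0); apply: le_trans i1 k1.
have k0 : 0 < k.+2%:R :> R by [].
have K_le : K <= `|K| by exact: ler_norm.
have win : `|V t w i| <= \sum_j `|V (idx k.+2%:R) w j| + 2 * `|K|.
  apply: (le_trans (noise_window w i it)); rewrite lerD2l.
  have gap : 0 <= S t - S (idx k.+2%:R) <= 2.
    rewrite subr_ge0 -(clock_le alpha_gt0) it /=.
    by move: i2 (alpha01 (idx k.+2%:R)); rewrite clockS; lra.
  case/andP: gap => gap0 gap2; rewrite mulrC.
  by apply: (le_trans (ler_wpM2l gap0 K_le)); rewrite ler_wpM2r.
rewrite normrM normfV (gtr0_norm St0).
apply: (@le_trans _ _ ((\sum_j `|V (idx k.+2%:R) w j| + 2 * `|K|) / S t)).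
  by rewrite ler_pM2r ?invr_gt0.
have -> : e = e / 2 + e / 2 by field.
rewrite mulrDl; apply: lerD; last first.
  move: small; rewrite !normrM normfV normr_id (gtr0_norm St0) (ger0_norm (ler0n _ 2)).
  exact: ltW.
apply: (@le_trans _ _ (Q k)).
  rewrite /Q -mulr_suml ler_wpM2l ?sumr_ge0 // lef_pV2 ?posrE //.
exact: le_trans (ler_norm _) (MQ k kM).
Qed.

End noise.

(** * Discretizing strategy profiles *)

Lemma coord_le_norm {R : realType} k (v : 'rV[R]_k) j : `|v ord0 j| <= `|v|.
Proof.
rewrite /Num.norm /= mx_normrE.
exact: (le_bigmax _ (fun ij : 'I_1 * 'I_k => `|v ij.1 ij.2|) (ord0, j)).
Qed.

Lemma norm_le_coord {R : realType} k (v : 'rV[R]_k) e : 0 <= e ->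
  (forall j, `|v ord0 j| <= e) -> `|v| <= e.
Proof.
move=> e0 ve; rewrite /Num.norm /= mx_normrE; apply: bigmax_le => // -[i j] _ /=.
by rewrite ord1.
Qed.

Section profile_cells.
Context {R : realType} {N : nat} {n : 'I_N -> nat}.
Variables (X : forall i : 'I_N, set 'rV[R]_(n i)).
Arguments X : clear implicits.
Variables (b : R) (p0 : profile R n).
Hypothesis Xb : forall i z, X i z -> `|z| <= b.
Hypothesis Xp0 : profiles X p0.

Definition coordinate := {i : 'I_N & 'I_(n i)}.

Definition threshold (m z : nat) : R := - b + z%:R / m.+1%:R.

(** Enough for the thresholds to reach past [b]. *)
Definition thresholds (m : nat) : nat := (Num.truncn (2 * b * m.+1%:R)).+2.

(** The cell of a profile records which thresholds its coordinates pass: the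
event that a random profile lies in a given cell is then a finite intersection
of half-line events. *)
Definition profile_cell (m : nat) (p : profile R n) :
    {ffun coordinate * 'I_(thresholds m) -> bool} :=
  [ffun cz : coordinate * 'I_(thresholds m) => threshold m cz.2 <= p (tag cz.1) ord0 (tagged cz.1)].

Definition cell_point (m : nat) (c : {ffun coordinate * 'I_(thresholds m) -> bool}) :
    profile R n :=
  if pselect (exists p, profiles X p /\ profile_cell m p = c) is left ex
  then projT1 (cid ex) else p0.

Lemma cell_point_in m c : profiles X (cell_point (m := m) c).
Proof. by rewrite /cell_point; case: pselect => // ex; case: (cid ex) => p []. Qed.

Lemma profile_cell_close m p q i k : profiles X p -> profiles X q ->
  profile_cell m p = profile_cell m q -> p i ord0 k < q i ord0 k + m.+1%:R^-1.
Proof.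
move=> Xp Xq pq; rewrite ltNge; apply/negP => far.
have m0 : 0 < m.+1%:R :> R by [].
have qb : - b <= q i ord0 k <= b.
  by rewrite -ler_norml (le_trans (coord_le_norm _ _)) ?Xb.
have pb : p i ord0 k <= b.
  by apply: le_trans (ler_norm _) _; rewrite (le_trans (coord_le_norm _ _)) ?Xb.
have r0 : 0 <= (q i ord0 k + b) * m.+1%:R by rewrite mulr_ge0 // -lerBlDr sub0r; case/andP: qb.
have /andP[z1 z2] := Num.Theory.truncn_itv r0.
set z := (Num.truncn _).+1 in z2.
have zM : (z < thresholds m)%N.
  rewrite ltnS ltnS; apply: Num.Theory.le_truncn; rewrite ler_pM2r //; lra.
have /ffunP/(_ (existT _ i k, Ordinal zM)) := pq.
rewrite !ffunE /= => same.
have q_lt : q i ord0 k < threshold m z.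
  by rewrite /threshold -ltrBlDl opprK ltr_pdivlMr.
have : threshold m z <= p i ord0 k.
  rewrite (le_trans _ far) // /threshold /z -natr1 mulrDl mul1r addrA lerD2r.
  by rewrite -lerBrDl opprK ler_pdivrMr.
by rewrite same leNgt q_lt.
Qed.

Lemma cell_point_cvg p i : profiles X p ->
  cell_point (profile_cell m p) i @[m --> \oo] --> p i.
Proof.
move=> Xp.
have close m : `|p i - cell_point (profile_cell m p) i| <= m.+1%:R^-1.
  have [Xq qp] : profiles X (cell_point (profile_cell m p)) /\
      profile_cell m (cell_point (profile_cell m p)) = profile_cell m p.
    rewrite /cell_point; case: pselect => [ex|nex]; first by case: (cid ex) => q [].
    by exfalso; apply: nex; exists p.
  apply: norm_le_coord => [|j]; first by rewrite invr_ge0.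
  have h1 := profile_cell_close j Xp Xq (esym qp).
  have h2 := profile_cell_close j Xq Xp qp.
  rewrite mxE [X in `|_ + X|]mxE ler_norml lerBlDl (ltW h1).
  by rewrite lerBrDl lerBlDr ltW.
apply/cvgrPdist_lt => e e0; have /cvgr0Pnorm_lt/(_ _ e0) := @cvg_harmonic R.
by apply: filterS => m /(le_lt_trans (ler_norm _)); exact: le_lt_trans (close m).
Qed.

Lemma profile_cell_measurable d (T : measurableType d) (xi : T -> profile R n) m c :
  (forall i k, measurable_fun setT (fun t => xi t i ord0 k)) ->
  measurable [set t | profile_cell m (xi t) = c].
Proof.
move=> mxi.
have -> : [set t | profile_cell m (xi t) = c] =
    \bigcap_(cz in [set: coordinate * 'I_(thresholds m)])
    [set t | (threshold m cz.2 <= xi t (tag cz.1) ord0 (tagged cz.1)) = c cz].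
  apply/seteqP; split=> t /=; first by move=> <- cz _; rewrite ffunE.
  by move=> h; apply/ffunP => cz; rewrite ffunE; exact: (h cz).
apply: fin_bigcap_measurable => [|cz _]; first exact: finite_finset.
pose g t := xi t (tag cz.1) ord0 (tagged cz.1).
have mge (r : R) : measurable [set t | r <= g t].
  rewrite -[X in measurable X]setTI.
  have -> : [set t | r <= g t] = g @^-1` `[r, +oo[%classic.
    by apply/seteqP; split=> t; rewrite /= in_itv /= andbT.
  by apply: mxi => //; exact: measurable_itv.
case: (c cz).
  by rewrite (_ : [set _ | _] = [set t | threshold m cz.2 <= g t]).
rewrite (_ : [set _ | _] = ~` [set t | threshold m cz.2 <= g t]); first exact: measurableC.
by apply/seteqP; split=> t /=; [move=> ->|move/negP/negbTE].
Qed.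

End profile_cells.

(** * The learning process *)

Section process.
Context {R : realType} {d : measure_display} {Omega : measurableType d}.
Context (P : probability Omega R) {N : nat} {n : 'I_N -> nat} {Theta : finType}.
Variables (X : forall i : 'I_N, set 'rV[R]_(n i)).
Arguments X : clear implicits.
Variables (ths : Theta) (u : 'I_N -> profile R n -> Theta -> R).
Variables (f : 'I_N -> R -> profile R n -> Theta -> R).
Variables (Y : 'I_N -> profile R n -> set R) (W : 'M[R]_N) (alpha : nat -> R).
Variables (x : nat -> Omega -> profile R n) (y : nat -> Omega -> 'I_N -> R).
Hypothesis hX : forall i, convex_set (X i) /\ compact (X i).
Hypothesis hf : likelihood_model X u f Y.
Hypothesis alpha01 : forall t, 0 < alpha t < 1.
Hypothesis hproc : learning_process f W alpha x y P X u ths.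
Variable L : R.
Hypothesis ratio_bound : forall i th' th'' x0, profiles X x0 ->
  forall v, Y i x0 v -> `|ln (f i v x0 th' / f i v x0 th'')| <= L.
Hypothesis f_cont : forall i th v,
  {within profiles X, continuous (fun x0 => f i v x0 th)}.
Local Notation E g := (\int[P]_w g w)%R.
Local Notation leb := (@lebesgue_measure R).

Lemma strategies_in t w : profiles X (x t w).
Proof.
have [_ _ x0 _ xS] := hproc; elim: t => [|t IH]; first exact: x0.
move=> i; have [z [Xz _] ->] := xS t w i.
have := convexX hX Xz (IH i) (s := alpha t); rewrite addrC; apply.
by case/andP: (alpha01 t) => a0 a1; rewrite !ltW.
Qed.

Lemma likelihood_density i s th : profiles X s -> density (fun v => f i v s th).
Proof.
move=> Xs; have [mf fpos f0 [f1 _ _]] := hf i th Xs; split=> // v.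
by have [/fpos/ltW|/f0->] := pselect (Y i s v).
Qed.

Lemma likelihood_support i s v th th' : profiles X s -> 0 < f i v s th -> 0 < f i v s th'.
Proof.
move=> Xs fv; have [_ _ f0 _] := hf i th Xs; have [_ fpos _ _] := hf i th' Xs.
by apply: fpos; apply: contrapT => /f0 fv0; move: fv; rewrite fv0 ltxx.
Qed.

Section log_likelihood.
Variable th : Theta.

(** A difference of logarithms rather than the logarithm of a quotient: each term is
measurable in the observed cost, and off the support both vanish because [ln 0 = 0]. *)
Definition log_ratio (i : 'I_N) (s : profile R n) (v : R) : R :=
  ln (f i v s ths) - ln (f i v s th).

Lemma log_ratioE i s v : profiles X s ->
  f i v s ths * ln (f i v s ths / f i v s th) = log_ratio i s v * f i v s ths.
Proof.
move=> Xs; rewrite mulrC /log_ratio.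
have [_ fpos f0 _] := hf i ths Xs; have [_ fpos' _ _] := hf i th Xs.
have [Yv|/f0->] := pselect (Y i s v); last by rewrite !mulr0.
by rewrite ln_div // posrE; [exact: fpos|exact: fpos'].
Qed.

Lemma log_ratio_bound i s v : profiles X s -> `|log_ratio i s v| <= `|L|.
Proof.
move=> Xs; rewrite /log_ratio.
have [_ fpos f0 _] := hf i ths Xs; have [_ fpos' f0' _] := hf i th Xs.
have [Yv|nYv] := pselect (Y i s v); last by rewrite f0 // f0' // subrr normr0.
rewrite -ln_div ?posrE; [|exact: fpos|exact: fpos'].
by apply: le_trans (ler_norm L); exact: ratio_bound.
Qed.

Lemma log_ratio_measurable i s : profiles X s -> measurable_fun setT (log_ratio i s).
Proof.
move=> Xs; have [mf _ _] := likelihood_density i ths Xs.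
have [mf' _ _] := likelihood_density i th Xs.
by apply: measurable_funB; apply: (measurableT_comp (@measurable_ln R)).
Qed.

Lemma f_cvg i th' v (s : nat -> profile R n) a : (forall k, profiles X (s k)) ->
  profiles X a -> (forall j, s k j @[k --> \oo] --> a j) ->
  f i v (s k) th' @[k --> \oo] --> f i v a th'.
Proof. by move=> Xs Xa sa; exact: (cvg_within_profile _ (@f_cont i th' v) Xa Xs sa). Qed.

Lemma log_ratio_cvg i v (s : nat -> profile R n) a : (forall k, profiles X (s k)) ->
  profiles X a -> (forall j, s k j @[k --> \oo] --> a j) -> 0 < f i v a ths ->
  log_ratio i (s k) v @[k --> \oo] --> log_ratio i a v.
Proof.
move=> Xs Xa sa fa; have fa' := likelihood_support th Xa fa.
by apply: cvgB; apply: continuous_cvg; [exact: continuous_ln|exact: f_cvg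
  |exact: continuous_ln|exact: f_cvg].
Qed.

Definition divergence (i : 'I_N) (s : profile R n) : R :=
  density_integral (fun v => f i v s ths) (log_ratio i s).

Lemma log_ratio_bounded_measurable i s : profiles X s -> bounded_measurable (log_ratio i s).
Proof.
move=> Xs; split; first exact: log_ratio_measurable.
by exists `|L| => v; exact: log_ratio_bound.
Qed.

Lemma divergenceE i s : profiles X s ->
  KL (fun v => f i v s ths) (fun v => f i v s th) = (divergence i s)%:E.
Proof.
move=> Xs; rewrite /KL; under eq_integral do rewrite log_ratioE //.
rewrite /divergence /density_integral /Rintegral fineK //.
apply: integrable_fin_num => //; apply: bounded_times_density.
  exact: likelihood_density.
exact: log_ratio_bounded_measurable.
Qed.

Lemma divergence_continuous i : {within profiles X, continuous (divergence i)}.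
Proof.
apply: sequentially_within_continuous => s a Xs Xa sa.
apply: (cvg_density_integral (p_ := fun k v => f i v (s k) ths)
  (phi_ := fun k => log_ratio i (s k)) (K := `|L|)).
- by move=> k; exact: likelihood_density.
- exact: likelihood_density.
- by move=> v; exact: f_cvg.
- by move=> k; exact: log_ratio_measurable.
- exact: log_ratio_measurable.
- by move=> k v; exact: log_ratio_bound.
- by move=> v fv; exact: log_ratio_cvg.
Qed.

Lemma divergence_bound i s : profiles X s -> `|divergence i s| <= `|L|.
Proof.
move=> Xs; apply: density_integral_norm_le; first exact: likelihood_density.
  exact: log_ratio_measurable.
by move=> v; exact: log_ratio_bound.
Qed.

(** Gibbs' inequality, from [ln r <= r - 1] integrated against the density. *)
Lemma divergence_ge0 i s : profiles X s -> 0 <= divergence i s.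
Proof.
move=> Xs; have dp := likelihood_density i ths Xs; have dq := likelihood_density i th Xs.
have := Rintegral_density dp; have := Rintegral_density dq => q1 p1.
have ip := density_integrable dp; have iq := density_integrable dq.
have ib := bounded_times_density dp (log_ratio_bounded_measurable i Xs).
rewrite -(subrr 1) -{1}p1 -q1 -RintegralB // /divergence /density_integral.
apply: le_Rintegral => //; first exact: (integrableB measurableT ip iq).
move=> v _; rewrite -log_ratioE //.
have [_ fpos f0 _] := hf i ths Xs; have [_ fpos' f0' _] := hf i th Xs.
have [Yv|nYv] := pselect (Y i s v); last by rewrite f0 // f0' // subrr mul0r.
have p0 := fpos _ Yv; have q0 := fpos' _ Yv.
set p := f i v s ths in p0 *; set q := f i v s th in q0 *.
have lnqp : ln (q / p) <= q / p - 1.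
  have -> : q / p = 1 + (q / p - 1) by ring.
  rewrite (addrC 1) addrK addrC; apply: le_ln1Dx.
  by rewrite ltrBrDl subrr divr_gt0.
have -> : p - q = p * (1 - q / p) by field; rewrite gt_eqF.
apply: ler_wpM2l; first exact: ltW.
rewrite ln_div ?posrE // in lnqp; rewrite ln_div ?posrE //.
move: (ln p) (ln q) (q / p) lnqp => a b c; lra.
Qed.

End log_likelihood.

(** Generators of [past], named so that measurability with respect to the past is
measurability on [g_sigma_algebraType (past_events t)]. *)
Definition past_events (t : nat) : set (set Omega) :=
  [set A | (exists (s : nat) (i : 'I_N) (k : 'I_(n i)) (B : set R),
          [/\ (s <= t)%N, measurable B & A = (fun w => x s w i ord0 k) @^-1` B]) \/
       (exists (s : nat) (i : 'I_N) (B : set R),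
          [/\ (s < t)%N, measurable B & A = (fun w => y s w i) @^-1` B])].

Lemma past_mono t : <<s past_events t>> `<=` <<s past_events t.+1>>.
Proof.
apply: sub_sigma_algebra2 => A [[s [i [k [B [st mB ->]]]]]|[s [i [B [st mB ->]]]]].
  by left; exists s, i, k, B; split=> //; exact: leqW.
by right; exists s, i, B; split=> //; exact: leqW.
Qed.

Lemma past_measurable t : <<s past_events t>> `<=` measurable.
Proof.
have [mx my _ _ _] := hproc.
apply: smallest_sub; first exact: sigma_algebra_measurable.
move=> A [[s [i [k [B [st mB ->]]]]]|[s [i [B [st mB ->]]]]].
  by rewrite -[X in measurable X]setTI; exact: mx.
by rewrite -[X in measurable X]setTI; exact: my.
Qed.

Lemma past_strategy s t i k : (s <= t)%N -> measurable_fun setT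
  ((fun w => x s w i ord0 k) : g_sigma_algebraType (past_events t) -> R).
Proof.
move=> st _ B mB; rewrite setTI; apply: sub_gen_smallest.
by left; exists s, i, k, B.
Qed.

Lemma past_cost s t i : (s < t)%N -> measurable_fun setT
  ((fun w => y s w i) : g_sigma_algebraType (past_events t) -> R).
Proof.
move=> st _ B mB; rewrite setTI; apply: sub_gen_smallest.
by right; exists s, i, B.
Qed.

(** The marginal of one cost; the other densities integrate to 1. *)
Lemma cost_law t i A B : <<s past_events t>> A -> measurable B ->
  E (fun w => \1_A w * \1_B (y t w i))
  = E (fun w => \1_A w * density_integral (fun v => f i v (x t w) ths) \1_B).
Proof.
move=> GA mB; have [_ my _ draw _] := hproc.
have mA := past_measurable GA.
pose Bs j : set R := if j == i then B else setT.
have mBs j : measurable (Bs j) by rewrite /Bs; case: ifP.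
have := draw t A Bs GA mBs.
have -> : A `&` [set w | forall j, Bs j (y t w j)] = A `&` (fun w => y t w i) @^-1` B.
  apply/seteqP; split=> w /= [Aw Bw]; split=> //.
    by have := Bw i; rewrite /Bs eqxx.
  by move=> j; rewrite /Bs; case: eqP => // ->.
have mC : measurable (A `&` (fun w => y t w i) @^-1` B).
  by apply: measurableI => //; rewrite -[X in measurable X]setTI; exact: my.
move/(congr1 fine); rewrite -(expect_indic P mC) => drawn.
transitivity (E (\1_(A `&` (fun w => y t w i) @^-1` B))).
  by apply: eq_Rintegral => w _; rewrite indicI.
rewrite drawn; transitivity (\int[P]_(w in A)
    density_integral (fun v => f i v (x t w) ths) \1_B)%R; last first.
  rewrite Rintegral_mkcond; apply: eq_Rintegral => w _.
  by rewrite /patch indicE; case: (_ \in A); rewrite ?mul1r ?mul0r.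
apply: eq_Rintegral => w _; rewrite density_integral_indic //.
rewrite (bigD1 i) //= big1 ?mulr1 => [|j /negbTE ji]; first by rewrite /Bs eqxx.
by rewrite /Bs ji Rintegral_density //; apply: likelihood_density; exact: strategies_in.
Qed.

Definition cell_radius : R := projT1 (cid2 (strategy_bound hX)).

Lemma cell_radiusP i z : X i z -> `|z| <= cell_radius.
Proof. by move=> Xz; rewrite /cell_radius; case: cid2 => K K0 KP /=; exact: KP Xz. Qed.

Let state_cell t m w := profile_cell cell_radius m (x t w).
Let state_rep m := cell_point X (x 0%N point) (b := cell_radius) (m := m).

Lemma state_rep_in m c : profiles X (state_rep (m := m) c).
Proof. by apply: cell_point_in; exact: strategies_in. Qed.

Lemma state_rep_cvg t w j : state_rep (state_cell t m w) j @[m --> \oo] --> x t w j.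
Proof.
by apply: cell_point_cvg; [exact: cell_radiusP|exact: strategies_in..].
Qed.

Lemma state_cell_past s t m c : (s <= t)%N ->
  <<s past_events t>> [set w | state_cell s m w = c].
Proof.
move=> st; apply: (profile_cell_measurable (T := g_sigma_algebraType (past_events t))).
by move=> i k; exact: past_strategy.
Qed.

(** The likelihood is only separately measurable in the cost and continuous in the
profile; discretizing the profile makes the composite measurable. *)
Lemma likelihood_at_sample_past t j th' : measurable_fun setT
  ((fun w => f j (y t w j) (x t w) th') : g_sigma_algebraType (past_events t.+1) -> R).
Proof.
apply: (measurable_state_fun (T := g_sigma_algebraType (past_events t.+1))
  (cell := state_cell t) (rep := state_rep)
  (h := fun s w => f j (y t w j) s th')).
- by move=> m c; exact: state_cell_past.
- move=> m c; have [mf _ _] := likelihood_density j th' (state_rep_in c).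
  by apply: (measurableT_comp mf); exact: past_cost.
- move=> w; apply: f_cvg => [m||i]; first exact: state_rep_in.
    exact: strategies_in.
  exact: state_rep_cvg.
Qed.

Lemma sample_in_support t j : {ae P, forall w, 0 < f j (y t w j) (x t w) ths}.
Proof.
have [_ my _ _ _] := hproc.
apply: (density_at_sample_gt0 (good := profiles X) (cell := state_cell t) (rep := state_rep)
  (dens := fun s v => f j v s ths) (G := past_events t)).
- by move=> w; exact: strategies_in.
- by move=> m c; exact: state_rep_in.
- by move=> s Xs; exact: likelihood_density.
- move=> w v; apply: f_cvg => [m||i]; first exact: state_rep_in.
    exact: strategies_in.
  exact: state_rep_cvg.
- exact: past_measurable.
- by move=> m c; exact: state_cell_past.
- exact: my.
- by move=> A B; exact: cost_law.
Qed.

Section noise_of_ratio.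
Variable th : Theta.

Definition ratio_noise (t : nat) (j : 'I_N) (w : Omega) : R :=
  log_ratio th j (x t w) (y t w j) - divergence th j (x t w).

Let ratio_past t j : measurable_fun setT
  ((fun w => log_ratio th j (x t w) (y t w j)) : g_sigma_algebraType (past_events t.+1) -> R).
Proof.
by apply: measurable_funB; apply: (measurableT_comp (@measurable_ln R));
  exact: likelihood_at_sample_past.
Qed.

Let rep_ratio_cvg t j w v : 0 < f j v (x t w) ths ->
  log_ratio th j (state_rep (state_cell t m w)) v @[m --> \oo]
  --> log_ratio th j (x t w) v.
Proof.
move=> fv; apply: log_ratio_cvg => // [m||i]; first exact: state_rep_in.
  exact: strategies_in.
exact: state_rep_cvg.
Qed.

Let divergence_past t j : measurable_fun setT
  ((fun w => divergence th j (x t w)) : g_sigma_algebraType (past_events t) -> R).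
Proof.
apply: (state_integral_measurable (good := profiles X) (cell := state_cell t)
  (rep := state_rep) (dens := fun s v => f j v s ths) (G := past_events t)).
- by move=> w; exact: strategies_in.
- by move=> m c; exact: state_rep_in.
- by move=> s Xs; exact: likelihood_density.
- move=> w v; apply: f_cvg => [m||i]; first exact: state_rep_in.
    exact: strategies_in.
  exact: state_rep_cvg.
- by move=> m c; exact: state_cell_past.
- by move=> s Xs; exact: log_ratio_measurable.
- by move=> s Xs v; exact: log_ratio_bound.
- by move=> w v; exact: rep_ratio_cvg.
Qed.

Lemma ratio_noise_past t j : measurable_fun setT
  (ratio_noise t j : g_sigma_algebraType (past_events t.+1) -> R).
Proof.
apply: measurable_funB; first exact: ratio_past.
move=> _ B mB; rewrite setTI; apply: (@past_mono t).
by have := @divergence_past t j measurableT B mB; rewrite setTI.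
Qed.

Lemma ratio_noise_bound t j w : `|ratio_noise t j w| <= 2 * `|L|.
Proof.
rewrite mulr2n mulrDl mul1r; apply: (le_trans (ler_normB _ _)); apply: lerD.
  by apply: log_ratio_bound; exact: strategies_in.
by apply: divergence_bound; exact: strategies_in.
Qed.

Lemma ratio_noise_centred t j A : <<s past_events t>> A ->
  E (fun w => \1_A w * ratio_noise t j w) = 0.
Proof.
move=> GA; have [_ my _ _ _] := hproc; have mA := past_measurable GA.
have bA := bounded_measurable_indic (R := R) mA.
have bratio : bounded_measurable (fun w => log_ratio th j (x t w) (y t w j)).
  split; first exact: (sub_measurable (@past_measurable t.+1) (@ratio_past t j)).
  by exists `|L| => w; apply: log_ratio_bound; exact: strategies_in.
have bdiv : bounded_measurable (fun w => divergence th j (x t w)).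
  split; first exact: (sub_measurable (@past_measurable t) (@divergence_past t j)).
  by exists `|L| => w; apply: divergence_bound; exact: strategies_in.
under eq_Rintegral do rewrite /ratio_noise mulrBr.
rewrite expectB; try exact: bounded_measurableM.
apply/eqP; rewrite subr_eq0; apply/eqP.
apply: (law_state (good := profiles X) (st := x t) (cell := state_cell t) (rep := state_rep)
  (dens := fun s v => f j v s ths) (G := past_events t) (y := fun w => y t w j)).
- by move=> w; exact: strategies_in.
- by move=> m c; exact: state_rep_in.
- by move=> s Xs; exact: likelihood_density.
- move=> w v; apply: f_cvg => [m||i]; first exact: state_rep_in.
    exact: strategies_in.
  exact: state_rep_cvg.
- exact: past_measurable.
- by move=> m c; exact: state_cell_past.
- exact: my.
- by move=> B C; exact: cost_law.
- exact: GA.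
- by move=> s Xs; exact: log_ratio_measurable.
- by move=> s Xs v; exact: log_ratio_bound.
- by move=> w v; exact: rep_ratio_cvg.
- by apply: filterS (sample_in_support t j) => w; exact: rep_ratio_cvg.
- exact: bratio.1.
Qed.

(** The share of the noise in the log-beliefs, pooled as they are. *)
Fixpoint pooled_noise (t : nat) (w : Omega) : 'I_N -> R :=
  if t is s.+1
  then averaged W (fun j => pooled_noise s w j + alpha s * ratio_noise s j w)
  else fun=> 0.

Lemma pooled_noise_negligible (A2 : R) : row_stochastic W ->
  clock alpha @ \oo --> +oo -> (forall T, \sum_(0 <= t < T) alpha t ^+ 2 <= A2) ->
  {ae P, forall w, forall i, pooled_noise t w i / clock alpha t @[t --> \oo] --> 0}.
Proof.
move=> sW clock_oo sqr.
apply: (noise_negligible sW alpha01 clock_oo sqr past_mono past_measurable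
  ratio_noise_past ratio_noise_bound ratio_noise_centred) => //.
Qed.
End noise_of_ratio.

Lemma belief_gt0 t w i th : (forall s j, 0 < f j (y s w j) (x s w) ths) ->
  0 < belief f W alpha x y t w i th.
Proof.
move=> good; elim: t i th => [|s IH] j th'.
  by rewrite /= invr_gt0 ltr0n; apply/card_gt0P; exists th'.
rewrite /= /log_linear_pool divr_gt0 ?expR_gt0 //.
by rewrite (bigD1 th') //= ltr_pwDl ?expR_gt0 // sumr_ge0.
Qed.

(** On the event that all costs fall in the supports, taking logarithms turns
Bayes updating followed by log-linear pooling into linear averaging. *)
Lemma log_belief_ratioS th t w i : (forall s j, 0 < f j (y s w j) (x s w) ths) ->
  let lam s j := ln (belief f W alpha x y s w j ths / belief f W alpha x y s w j th) in
  lam t.+1 i = averaged W (fun j => lam t j + alpha t * log_ratio th j (x t w) (y t w j)) i.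
Proof.
move=> good lam.
have fpos s j th' : 0 < f j (y s w j) (x s w) th'.
  by apply: likelihood_support (good s j); exact: strategies_in.
have bpos s j th' : 0 < belief f W alpha x y s w j th' by exact: belief_gt0.
pose Bj j := bayes_update (alpha t) (f j (y t w j) (x t w)) (belief f W alpha x y t w j).
have Zpos j : 0 < \sum_th' (f j (y t w j) (x t w) th' `^ alpha t * belief f W alpha x y t w j th').
  rewrite (bigD1 ths) //= ltr_pwDl ?mulr_gt0 ?powR_gt0 // sumr_ge0 // => th'' _.
  by rewrite mulr_ge0 ?powR_ge0 // ltW.
have Bpos j th' : 0 < Bj j th' by rewrite divr_gt0 ?mulr_gt0 ?powR_gt0.
have lnB j th' : ln (Bj j th') = alpha t * ln (f j (y t w j) (x t w) th')
    + ln (belief f W alpha x y t w j th')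
    - ln (\sum_th' (f j (y t w j) (x t w) th' `^ alpha t * belief f W alpha x y t w j th')).
  by rewrite /Bj /bayes_update ln_div ?posrE ?mulr_gt0 ?powR_gt0 // lnM ?posrE ?powR_gt0 // ln_powR.
have Dpos : 0 < \sum_th' expR (\sum_j W i j * ln (Bj j th')).
  by rewrite (bigD1 ths) //= ltr_pwDl ?expR_gt0 // sumr_ge0.
rewrite /lam /= /log_linear_pool -/Bj.
have pool_ratio (p q z : R) : 0 < z -> ln (expR p / z / (expR q / z)) = p - q.
  move=> z0; rewrite -[RHS]expRK expRB; congr ln.
  by field; rewrite !gt_eqF ?expR_gt0.
rewrite pool_ratio // -[LHS]/(averaged W (fun j => ln (Bj j ths)) i
  - averaged W (fun j => ln (Bj j th)) i) -averagedB.
apply: eq_bigr => j _; congr (_ * _); rewrite !lnB ln_div ?posrE // /log_ratio.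
ring.
Qed.

Variables (e : rel 'I_N) (mu : Omega -> Theta -> R)
  (xstar : (Theta -> R) -> profile R n).
Hypothesis hW : weight_matrix e W.
Hypothesis halpha : forall s t : nat, (s <= t)%N -> alpha t <= alpha s.
Hypothesis mu_limit : {ae P, forall w, is_belief (mu w) /\
  forall i th, belief f W alpha x y t w i th @[t --> \oo] --> mu w th}.
Hypothesis he : connected_network e.
Hypothesis hD : doubly_stochastic W.
Hypothesis clock_oo : clock alpha @ \oo --> +oo.
Hypothesis alpha_sqr : cvgn (fun T => \sum_(0 <= t < T) alpha t ^+ 2).
Hypothesis hu : forall i th, {within profiles X, continuous (fun x0 => u i x0 th)} /\
  strictly_convex_own X i (fun x0 => u i x0 th).
Hypothesis hode : {ae P, forall w,
  nash_equilibrium X u (mu w) (xstar (mu w)) /\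
  forall x0, profiles X x0 -> forall xb : R -> profile R n,
    best_response_dynamics X u (mu w) x0 xb -> xb t @[t --> +oo] --> xstar (mu w)}.

Lemma alpha_sqr_bound T : \sum_(0 <= t < T) alpha t ^+ 2
  <= limn (fun T => \sum_(0 <= t < T) alpha t ^+ 2).
Proof.
apply: nondecreasing_cvgn_le => //; apply/nondecreasing_seqP => k.
by rewrite big_nat_recr //= lerDl sqr_ge0.
Qed.

Lemma alpha_cvg0 : alpha @ \oo --> 0.
Proof.
have sqr0 : (fun t => alpha t ^+ 2) @ \oo --> 0 by apply: cvg_series_cvg_0.
apply/cvgr0Pnorm_lt => eps eps0.
have /cvgr0Pnorm_lt/(_ _ (exprn_gt0 2 eps0)) := sqr0.
by apply: filterS => t; rewrite normrX ltr_pXn2r // nnegrE ltW.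
Qed.

Lemma support_almost_surely :
  {ae P, forall w, forall s j, 0 < f j (y s w j) (x s w) ths}.
Proof.
apply: ae_foralln => s; apply: filter_forall => j; exact: sample_in_support.
Qed.

(** All but a vanishing proportion of clock time is spent near [xstar], whence
the drift averages to its value there. *)
Lemma log_belief_ratio_cvg th : {ae P, forall w, forall i,
  ln (belief f W alpha x y T w i ths / belief f W alpha x y T w i th) / clock alpha T
    @[T --> \oo] --> mean (fun j => divergence th j (xstar (mu w)))}.
Proof.
have sW := weight_row_stochastic hW hD.
have noise0 := pooled_noise_negligible th sW clock_oo alpha_sqr_bound.
have [_ _ _ _ xS] := hproc.
apply: filterS (filterI (filterI support_almost_surely noise0) (filterI mu_limit hode)).
move=> w [[good nz] [[bmu mulim] [[Xst _] ode]]] i.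
have exz t : exists z : forall j : 'I_N, 'rV[R]_(n j), forall j,
    best_response X u j (x t w) (belief f W alpha x y t.+1 w j) (z j) /\
    x t.+1 w j = (1 - alpha t) *: x t w j + alpha t *: z j.
  have ex j : exists z, best_response X u j (x t w) (belief f W alpha x y t.+1 w j) z /\
      x t.+1 w j = (1 - alpha t) *: x t w j + alpha t *: z.
    by have [z z1 z2] := xS t w j; exists z.
  by exists (fun j => projT1 (cid (ex j))) => j; case: (cid (ex j)).
have [zs zsP] := choice exz.
apply: (consensus_log_ratio (W := W) (e := e)
  (lam := fun t j => ln (belief f W alpha x y t w j ths / belief f W alpha x y t w j th))
  (V := fun t => pooled_noise th t w)
  (ell := fun t j => log_ratio th j (x t w) (y t w j))
  (D := fun t j => divergence th j (x t w))) => //.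
- by move=> t; case/andP: (alpha01 t) => /ltW.
- by move=> t; exact: halpha.
- move=> j; rewrite /= divff ?ln1 // invr_eq0 pnatr_eq0 -lt0n.
  by apply/card_gt0P; exists ths.
- by move=> t j; exact: log_belief_ratioS.
move=> j.
have g_cont : {within profiles X,
    continuous (fun s => `|divergence th j s - divergence th j (xstar (mu w))|)}.
  move=> s; apply: cvg_norm; apply: cvgB; last exact: cvg_cst.
  exact: (@divergence_continuous th j s).
apply: (clock_average_cvg0 hX hu (zs := zs) (m := fun t j => belief f W alpha x y t.+1 w j)
  (mu := mu w) (xst := xstar (mu w)) alpha01 alpha_cvg0 clock_oo _ _ _ bmu _ Xst ode
  (G := 2 * `|L|) g_cont).
- by move=> t; exact: strategies_in.
- by move=> t k; case: (zsP t k).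
- by move=> t k; case: (zsP t k).
- by move=> k th'; have := mulim k th'; rewrite -cvg_shiftS.
- move=> s Xs; rewrite normr_ge0 /= mulr2n mulrDl mul1r (le_trans (ler_normB _ _)) //.
  by rewrite lerD // divergence_bound.
- by rewrite subrr normr0.
Qed.

Lemma ZdivE th p : profiles X p ->
  Zdiv f p ths th = (mean (fun j => divergence th j p))%:E.
Proof.
move=> Xp; rewrite /Zdiv /mean EFinM; congr (_ * _)%E.
by rewrite -sumEFin; apply: eq_bigr => j _; exact: divergenceE.
Qed.

Hypothesis identifiable : forall th, th != ths -> exists i, forall x0, profiles X x0 ->
  (0 < KL (fun v => f i v x0 ths) (fun v => f i v x0 th))%E.

Lemma mean_divergence_gt0 th p : th != ths -> profiles X p ->
  0 < mean (fun j => divergence th j p).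
Proof.
move=> /identifiable[i KLi] Xp; have := KLi p Xp; rewrite divergenceE // lte_fin => Di.
have N0 : (0 < N)%N by case: (i) => k; exact: leq_trans.
rewrite /mean mulr_gt0 ?invr_gt0 ?ltr0n // (bigD1 i) //= ltr_pwDl // sumr_ge0 // => j _.
exact: divergence_ge0.
Qed.

(** The sum of step sizes starting at 1 differs from the clock by the constant
[alpha 0]. *)
Lemma log_ratio_rate th i : {ae P, forall w,
  (ln (belief f W alpha x y T.+1 w i ths / belief f W alpha x y T.+1 w i th)
    / \sum_(1 <= t < T.+1) alpha t)%:E @[T --> \oo] --> Zdiv f (xstar (mu w)) ths th}.
Proof.
apply: filterS2 (log_belief_ratio_cvg th) hode => w lim [[Xst _] _].
rewrite ZdivE //; apply: cvg_EFin; first exact: nearW.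
set lam := fun T => ln (belief f W alpha x y T w i ths / belief f W alpha x y T w i th).
set z := mean _.
have shift (h : nat -> R) (a : R) : h T @[T --> \oo] --> a -> h T.+1 @[T --> \oo] --> a.
  by rewrite -cvg_shiftS.
have lim1 : lam T.+1 / clock alpha T.+1 @[T --> \oo] --> z.
  by apply: (shift (fun T => lam T / clock alpha T)); exact: lim.
have lim2 : alpha 0%N / clock alpha T.+1 @[T --> \oo] --> 0.
  apply: (shift (fun T => alpha 0%N / clock alpha T)).
  exact: (bounded_over_diverging (fun=> lexx `|alpha 0%N|) clock_oo).
have lim3 : (1 - alpha 0%N / clock alpha T.+1)^-1 @[T --> \oo] --> (1 : R).
  have : (1 - alpha 0%N / clock alpha T.+1)^-1 @[T --> \oo] --> ((1 - 0)^-1 : R).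
    apply: cvgV; first by rewrite subr0 oner_neq0.
    by apply: cvgB => //; exact: cvg_cst.
  by rewrite subr0 invr1.
have lim4 : lam T.+1 / clock alpha T.+1 * (1 - alpha 0%N / clock alpha T.+1)^-1
    @[T --> \oo] --> z * 1 by exact: cvgM lim1 lim3.
rewrite mulr1 in lim4.
suff rE : (fun T => lam T.+1 / \sum_(1 <= t < T.+1) alpha t) =
    (fun T => lam T.+1 / clock alpha T.+1 * (1 - alpha 0%N / clock alpha T.+1)^-1).
  by rewrite -rE in lim4; exact: lim4.
apply/funext => T.
have S0 : 0 < clock alpha T.+1.
  have a0 t : 0 < alpha t by case/andP: (alpha01 t).
  by rewrite -(clock0 alpha) -(clock_lt a0).
have SE : \sum_(1 <= t < T.+1) alpha t = clock alpha T.+1 * (1 - alpha 0%N / clock alpha T.+1).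
  rewrite mulrBr mulr1 mulrCA divff ?mulr1 ?gt_eqF //.
  by rewrite /clock (big_ltn (ltn0Sn T)) addrAC subrr add0r.
by rewrite SE invfM mulrA.
Qed.

(** The limiting rate of each wrong parameter is positive, so its log-ratio diverges
with the clock and its limit belief is 0. *)
Lemma beliefs_concentrate i : {ae P, forall w,
  belief f W alpha x y t w i ths @[t --> \oo] --> (1 : R)}.
Proof.
have all_rates : {ae P, forall w, forall th, forall i,
    ln (belief f W alpha x y T w i ths / belief f W alpha x y T w i th) / clock alpha T
    @[T --> \oo] --> mean (fun j => divergence th j (xstar (mu w)))}.
  by apply: filter_forall => th; exact: log_belief_ratio_cvg.
apply: filterS (filterI (filterI support_almost_surely all_rates) (filterI mu_limit hode)).
move=> w [[good rates] [[[mu0 mu1] mulim] [[Xst _] _]]].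
suff mu_th th : th != ths -> mu w th = 0.
  have -> : 1 = mu w ths; last exact: mulim.
  by rewrite -mu1 (bigD1 ths) //= big1 ?addr0.
move=> thn; pose lam T := ln (belief f W alpha x y T w i ths / belief f W alpha x y T w i th).
have z0 := mean_divergence_gt0 thn Xst; set z := mean _ in z0.
have lam_oo : lam T @[T --> \oo] --> +oo.
  apply/cvgryPgt => A.
  have z20 : 0 < z / 2 by rewrite divr_gt0.
  have /cvgrPdist_lt/(_ _ z20) nz := rates th i.
  have /cvgryPgt/(_ (`|A| / (z / 2))) nS := clock_oo.
  apply: filterS2 nz nS => T; rewrite -/z -/(lam T) ltr_norml => /andP[_ hz] hS.
  have S0 : 0 < clock alpha T by apply: le_lt_trans hS; rewrite divr_ge0 // ltW.
  apply: (le_lt_trans (ler_norm A)); rewrite ltr_pdivrMr // in hS.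
  apply: (lt_trans hS); rewrite mulrC -ltr_pdivlMr //; lra.
have inv0 : (expR (lam T))^-1 @[T --> \oo] --> 0.
  apply/gtr0_cvgV0; first by apply: nearW => T; exact: expR_gt0.
  apply/cvgryPgt => A; have /cvgryPgt/(_ A) := lam_oo; apply: filterS => T /lt_trans; apply.
  by apply: lt_le_trans (expR_ge1Dx _); rewrite ltrDr.
have lim0 : belief f W alpha x y T w i ths * (expR (lam T))^-1 @[T --> \oo]
    --> mu w ths * 0 by exact: cvgM (mulim i ths) inv0.
rewrite mulr0 in lim0.
suff bE : (fun T => belief f W alpha x y T w i th)
    = (fun T => belief f W alpha x y T w i ths * (expR (lam T))^-1).
  have := mulim i th; rewrite bE => lim1.
  exact: (cvg_unique (@norm_hausdorff _ _) lim1 lim0).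
apply/funext => T.
have b1 := belief_gt0 T i ths good; have b2 := belief_gt0 T i th good.
rewrite /lam lnK ?posrE ?divr_gt0 // invf_div mulrC divfK // gt_eqF //.
Qed.

End process.

Unset Implicit Arguments.

Theorem theorem3 (R : realType) (d : measure_display) (Omega : measurableType d)
  (P : probability Omega R) (N : nat) (n : 'I_N -> nat)
  (X : forall i : 'I_N, set 'rV[R]_(n i)) (Theta : finType) (ths : Theta)
  (u : 'I_N -> profile R n -> Theta -> R)
  (f : 'I_N -> R -> profile R n -> Theta -> R)
  (Y : 'I_N -> profile R n -> set R)
  (e : rel 'I_N) (W : 'M[R]_N) (alpha : nat -> R)
  (x : nat -> Omega -> profile R n) (y : nat -> Omega -> 'I_N -> R)
  (nu mu : Omega -> Theta -> R) (xstar : (Theta -> R) -> profile R n)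
  (hX : forall i, convex_set (X i) /\ compact (X i))
  (hf : likelihood_model X u f Y)
  (hW : weight_matrix e W)
  (halpha : forall s t : nat, (s <= t)%N -> alpha t <= alpha s)
  (hproc : learning_process f W alpha x y P X u ths)
  (hmu : common_limit_belief f W alpha x y P ths nu mu)
  (h1 : (exists2 L : R, 0 < L & forall i th' th'' x0, profiles X x0 ->
           forall v, Y i x0 v -> `|ln (f i v x0 th' / f i v x0 th'')| <= L) /\
        (forall i th v, {within profiles X, continuous (fun x0 => f i v x0 th)}))
  (h2 : forall th, th != ths -> exists i, forall x0, profiles X x0 ->
          (0 < KL (fun v => f i v x0 ths) (fun v => f i v x0 th))%E)
  (h3 : connected_network e /\ doubly_stochastic W)
  (h4 : [/\ forall t, 0 < alpha t < 1,
            \sum_(0 <= t < T) alpha t @[T --> \oo] --> +oo &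
            cvgn (fun T => \sum_(0 <= t < T) alpha t ^+ 2)])
  (h5 : forall i th, {within profiles X, continuous (fun x0 => u i x0 th)} /\
          strictly_convex_own X i (fun x0 => u i x0 th))
  (h6 : {ae P, forall w,
          nash_equilibrium X u (mu w) (xstar (mu w)) /\
          forall x0, profiles X x0 ->
          forall xb : R -> profile R n,
            best_response_dynamics X u (mu w) x0 xb ->
            xb t @[t --> +oo] --> xstar (mu w)}) :
  (forall (i : 'I_N) (th : Theta), {ae P, forall w,
     (ln (belief f W alpha x y T.+1 w i ths / belief f W alpha x y T.+1 w i th)
      / \sum_(1 <= t < T.+1) alpha t)%:E @[T --> \oo]
     --> Zdiv f (xstar (mu w)) ths th}) /\
  (forall i : 'I_N, {ae P, forall w,
     belief f W alpha x y t w i ths @[t --> \oo] --> (1 : R)}).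
Proof.
have [[L L0 ratio_bound] f_cont] := h1; have [he hD] := h3.
have [alpha01 clock_oo alpha_sqr] := h4.
have mu_limit : {ae P, forall w, is_belief (mu w) /\
    forall i th, belief f W alpha x y t w i th @[t --> \oo] --> mu w th}.
  by apply: filterS hmu => w [].
split=> [i th|i].
  exact: (log_ratio_rate hX hf alpha01 hproc ratio_bound f_cont hW halpha mu_limit
    he hD clock_oo alpha_sqr h5 h6).
exact: (beliefs_concentrate hX hf alpha01 hproc ratio_bound f_cont hW halpha mu_limit
  he hD clock_oo alpha_sqr h5 h6 h2).
Qed.
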